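(* Let $\mathcal F$ be a partitioned holomorphic dynamical system on $\hat{\mathbb{C}}$, consisting of maps $f_j\colon U_j\to\hat{\mathbb{C}}$, $j=1,\dots,m$, with $m\ge 2$, and such that $\mathcal F(\mathcal U)\setminus PC(\mathcal F)$ is a nonempty open set. Then the number $$\delta_{\mathcal F}=\inf\{t\ge 0\colon \varrho(M(\mathcal F,t))=1\}$$ is well defined (i.e. the set on the right-hand side is nonempty), and $\delta_{\mathcal F}\le t_{\mathcal F}$, where $t_{\mathcal F}$ is the Poincaré exponent of $\mathcal F$.
   Context: A partitioned holomorphic dynamical system $\mathcal F$ on $\hat{\mathbb{C}}$ is a finite collection of holomorphic maps $f_j\colon U_j\to\hat{\mathbb{C}}$, $j=1,\dots,m$, such that: (1) the domains $U_j$ (called tiles) are pairwise disjoint open sets in $\hat{\mathbb{C}}$, and each $f_j$ is a proper branched (or unbranched) covering map of $U_j$ onto its image; (2) (Markov property) for every pair $i,j$, the image $f_i(U_i)$ either contains $U_j$ or is disjoint from it; (3) (transitivity) for each $U_j$ there is a finite sequence of maps $f_j=f_{i_0},f_{i_1},\dots,f_{i_k}$ from $\mathcal F$ such that the composition $f_{i_k}\circ\dots\circ f_{i_1}\circ f_{i_0}$ is defined on some open subset $U\subset U_j$ and maps $U$ surjectively onto $\bigcup_{i=1}^m U_i$. Put $\mathcal U=\bigcup_j U_j$ and $\mathcal F(\mathcal U)=\bigcup_j f_j(U_j)$, and view $\mathcal F$ as a single map $\mathcal F\colon\mathcal U\to\mathcal F(\mathcal U)$. Let $C(\mathcal F)=\{z\in\mathcal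 F(\mathcal U)\colon \exists w\in\mathcal F^{-1}(z)\text{ with }\mathcal F'(w)=0\}$ be the set of critical values. The forward orbit $\mathcal O(z)=\{z,\mathcal F(z),\mathcal F^{\circ2}(z),\dots\}$ consists of all iterates that are defined (it may be finite), and the postcritical set is $PC(\mathcal F)=\overline{\bigcup_{z\in C(\mathcal F)}\mathcal O(z)}$. All derivatives are with respect to the spherical metric on $\hat{\mathbb{C}}$. For $k\in\mathbb{N}$, $z\in\mathcal U\setminus PC(\mathcal F)$, $t>0$, let $$\Theta^k(z,t,\mathcal F)=\sum_{w\in\mathcal U\colon \mathcal F^{\circ k}(w)=z}|(\mathcal F^{\circ k})'(w)|^{-t},\qquad P(z,t,\mathcal F)=\limsup_{k\to\infty}\tfrac1k\log\Theta^k(z,t,\mathcal F),$$ $$P(t,\mathcal F)=\inf_{z\in\mathcal U\setminus PC(\mathcal F)}P(z,t,\mathcal F),\qquad t_{\mathcal F}=\inf\{t>0\colon P(t,\mathcal F)\le 0\}.$$ The number $t_{\mathcal F}$ is the Poincaré exponent. Let $d_j$ be the topological degree of the (branched) covering $f_j$. For $t\ge 0$, McMullen's matrix $M(\mathcal F,t)$ is the $m\times m$ matrix with entries $$m_{ij}=\begin{cases} d_i\left(\sup_{z\in U_i\cap f_i^{-1}(U_j)}|f_i'(z)|\right)^{-t} & \text{if } U_i\cap f_i^{-1}(U_j)\ne\varnothing,\\ 0 &\text{otherwise.}\end{cases}$$ $\varrho(A)$ denotes the spectral radius of a square matrix $A$.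
   Formalization: The suprema of |f_i'| in the entries of M(F,t) are assumed finite, so that the matrix is real; this does not follow from (1)–(3), and with infinite suprema (powers read as 0) the set defining δ_F can be empty. *)

(* Defs.v *)
From HB Require Import structures.
From mathcomp Require Import all_boot all_order all_algebra.
From mathcomp Require Import all_classical all_reals all_analysis.
From mathcomp Require Import complex.

Set Implicit Arguments.
Unset Strict Implicit.
Unset Printing Implicit Defensive.

Import Order.TTheory GRing.Theory Num.Theory.
Import numFieldNormedType.Exports ComplexField.Normc.

Local Open Scope classical_set_scope.
Local Open Scope ring_scope.

(* [Some z] is the point z of the plane and [None] is infinity. The regular
   module [R[i]^o] is what carries the norm topology. *)
Notation sphere R := (one_point_compactification (R[i]^o)).

Section Sphere.
Context {R : realType}.
Local Notation C := (R[i]^o).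
Implicit Types (U : set (sphere R)) (f : sphere R -> sphere R) (p : sphere R).

(* The chart z near a finite p, the chart 1/z near infinity; both are isometries
   for the spherical metric. The value of a chart at the one point outside its
   domain is immaterial, since charts are only used near p. *)
Definition chart p (q : sphere R) : C :=
  match p, q with
  | Some _, Some z => z
  | None, Some z => z^-1
  | _, None => 0
  end.

Definition chart_inv p (z : C) : sphere R :=
  if p is Some _ then Some z else if z == 0 then None else Some z^-1.

Definition chart_rep f p : C -> C := chart (f p) \o f \o chart_inv p.

Definition holomorphic_on U f := forall p, U p ->
  {for p, continuous f} /\ derivable (chart_rep f p) (chart p p) 1.

(* |dF(a)| for the metric 2|dz|/(1+|z|^2), where F is f read in the charts
   at p and f p. *)
Definition sderiv f p : R :=
  let F := chart_rep f p in
  let a := chart p p in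
  normc (derive1 F a) * (1 + normc a ^+ 2) / (1 + normc (F a) ^+ 2).

(* f takes the value f p at p with multiplicity exactly k. *)
Definition local_degree f p (k : nat) := (0 < k)%N /\
  let F := chart_rep f p in
  let a := chart p p in
  exists g : C -> C, [/\ {for a, continuous g}, g a != 0 &
    \forall z \near a, F z - F a = (z - a) ^+ k * g z].

Definition proper_onto_image U f := forall K : set (sphere R),
  K `<=` f @` U -> compact K -> compact (U `&` f @^-1` K).

(* Every point of the image has d preimages in U, with multiplicity. *)
Definition has_degree U f (d : nat) := forall z, (f @` U) z ->
  exists (s : seq (sphere R)) (mult : sphere R -> nat),
    [/\ uniq s, [set` s] = U `&` f @^-1` [set z],
        forall w, w \in s -> local_degree f w (mult w) &
        (\sum_(w <- s) mult w)%N = d].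

(* U need not be connected: the degree is required to be the same over all the
   components of the image, so that "the degree of f on U" makes sense. *)
Definition proper_branched_covering U f :=
  [/\ holomorphic_on U f, proper_onto_image U f & exists d, has_degree U f d].

Definition degree U f : nat := xget 0%N [set d | has_degree U f d].

End Sphere.

Section Composition.
Context {R : realType} {m : nat}.
Variables (U : 'I_m -> set (sphere R)) (f : 'I_m -> sphere R -> sphere R).

(* [:: i0; ...; ik] encodes the composition f_ik o ... o f_i0. *)
Definition compose (l : seq 'I_m) (z : sphere R) :=
  foldl (fun x i => f i x) z l.

Fixpoint composable (l : seq 'I_m) (z : sphere R) : Prop :=
  if l is i :: l' then U i z /\ composable l' (f i z) else True.

End Composition.

(* The maps are total functions whose values outside their tiles are never
   used. *)
Record partitioned_system (R : realType) (m : nat) := PartitionedSystem {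
  tile : 'I_m -> set (sphere R);
  branch : 'I_m -> sphere R -> sphere R;
  tile_open : forall i, open (tile i);
  tile_disjoint : forall i j, i != j -> tile i `&` tile j = set0;
  branch_covering : forall i, proper_branched_covering (tile i) (branch i);
  markov : forall i j, tile j `<=` branch i @` tile i \/
                       (branch i @` tile i) `&` tile j = set0;
  transitivity : forall j, exists (l : seq 'I_m) (W : set (sphere R)),
    [/\ open W, W `<=` tile j, W `<=` composable tile branch (j :: l) &
        compose branch (j :: l) @` W = \bigcup_i tile i] }.

Section System.
Context {R : realType} {m : nat}.
Variable F : partitioned_system R m.

Definition tiles : set (sphere R) := \bigcup_i tile F i.

Definition image_tiles : set (sphere R) := \bigcup_i (branch F i @` tile F i).

(* F as a single map; the value outside the tiles is a dummy. *)
Definition sysmap (z : sphere R) : sphere R :=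
  if [pick i | `[< tile F i z >]] is Some i then branch F i z else z.

(* The k-th iterate of F is defined at z. *)
Definition iter_defined (k : nat) (z : sphere R) :=
  forall l, (l < k)%N -> tiles (iter l sysmap z).

Definition critical_values : set (sphere R) :=
  [set z | image_tiles z /\
    exists w, [/\ tiles w, sysmap w = z & sderiv sysmap w = 0]].

Definition forward_orbit (z : sphere R) : set (sphere R) :=
  [set iter k sysmap z | k in [set k | iter_defined k z]].

Definition postcritical : set (sphere R) :=
  closure (\bigcup_(z in critical_values) forward_orbit z).

(* For z outside the postcritical set the derivatives below are nonzero, so the
   library's value 0 `^ (- t) = 0 plays no role. *)
Definition Theta (k : nat) (z : sphere R) (t : R) : \bar R :=
  (\esum_(w in [set w | [/\ tiles w, iter_defined k w & iter k sysmap w = z]])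
    (sderiv (iter k sysmap) w `^ (- t))%:E)%E.

Definition pressure_at (z : sphere R) (t : R) : \bar R :=
  limn_esup (fun k => ((k%:R^-1)%:E * lne (Theta k z t))%E).

Definition pressure (t : R) : \bar R :=
  ereal_inf [set pressure_at z t | z in tiles `\` postcritical].

(* +oo when the pressure is positive for every t. *)
Definition poincare_exponent : \bar R :=
  ereal_inf [set t%:E | t in [set t : R | 0 < t /\ (pressure t <= 0)%E]].

Definition transition_set (i j : 'I_m) : set (sphere R) :=
  tile F i `&` branch F i @^-1` tile F j.

Definition transition_derivs (i j : 'I_m) : set R :=
  [set sderiv (branch F i) z | z in transition_set i j].

(* [sup] is the least upper bound only on sets that are bounded above; it is 0
   on the others. *)
Definition mcmullen_matrix (t : R) : 'M[R]_m :=
  \matrix_(i < m, j < m)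
    if `[< transition_set i j !=set0 >] then
      (degree (tile F i) (branch F i))%:R *
        (sup (transition_derivs i j)) `^ (- t)
    else 0.

End System.

Definition spectral_radius (R : realType) (n : nat) (A : 'M[R]_n) : R :=
  sup [set r | exists2 a : R[i],
    eigenvalue (map_mx (fun x => x%:C%C) A) a & r = normc a].

Section Delta.
Context {R : realType} {m : nat}.
Variable F : partitioned_system R m.

Definition delta_set : set R :=
  [set t | 0 <= t /\ spectral_radius (mcmullen_matrix F t) = 1].

Definition delta : R := inf delta_set.

End Delta.

(* Main.v *)
Require Import Defs.
From mathcomp Require Import all_boot all_order all_algebra.
From mathcomp Require Import all_classical all_reals all_analysis.
From mathcomp Require Import complex ring lra.

Set Implicit Arguments.
Unset Strict Implicit.
Unset Printing Implicit Defensive.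

Import Order.TTheory GRing.Theory Num.Theory.
Import numFieldNormedType.Exports ComplexField.Normc.

Local Open Scope classical_set_scope.
Local Open Scope ring_scope.

(* Let M(t) be McMullen's matrix and r(t) its spectral radius. Transitivity makes
   M(t) irreducible, so r(t) is its Perron eigenvalue; r is continuous and
   r(0) >= 1. By the intermediate value theorem r takes the value 1 on [0, t]
   as soon as r(t) <= 1, and two things remain.

   (1) If P(t) <= 0 then r(t) <= 1. Over a point z of the tile j outside the
   postcritical set every iterated fibre is unramified, and replacing
   |(F^k)'(w)| by the product S(w) of the suprema along the itinerary of w turns
   Theta^k(z, t) into the j-th column sum of M(t)^k, which grows like r(t)^k.

   (2) r(t) <= 1 for some t, here t = 4. Let D be a closed disc with centre z
   in the tile j, free of postcritical points, and w a point with F^k(w) = z.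
   A segment from w of length less than c / S(w) is mapped into D by F^k, as
   F^k has spherical derivative at most S(w) along it and is proper over D.
   Contracting its image in D and lifting the homotopy shows that the segment
   contains no other preimage of z. Hence the points w are c / S(w)-separated,
   and a packing argument in the plane bounds the sum of the S(w)^-4, that is
   the j-th column sum of M(4)^k, independently of k. *)

(** * Complex differentiability *)

(** Tiles may be disconnected or multiply connected, so the separation in (2) rests neither on
    globally defined inverse branches nor on a distortion theorem. It rests on S(w), which depends
    only on the tiles visited: it is constant along every path inside the preimage of D and bounds
    the derivative on the whole of such a path. The lifting needs the preimage of D to be compact,
    which comes from properness and the Markov property, and the fibres over D to be unramified,
    which is the choice of D.

    A packing bound also needs the radii to be bounded above. Segments from w of length below c /
    S(w) stay in the tile of w and miss the points of every other tile, which uses m >= 2. As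
    neither chart is bounded on the sphere, points in the closed unit disc are packed in the chart
    z, the others in the chart 1/z.

    For (2) any exponent t with r(t) <= 1 serves. Exponent 4 lets a mere count of separated points
    suffice: it makes the terms of the sum decay like 1/n^2. *)

Section NumFieldDerivative.
Variable K : numFieldType.

Lemma derivable_slope (F : K^o -> K^o) (a : K^o) : derivable F a 1 ->
  forall e : K, 0 < e -> exists2 d : K, 0 < d & forall h, h != 0 -> `|h| < d ->
    `|h^-1 * (F (h + a) - F a) - F^`()%classic a| < e.
Proof.
move=> dF e e0.
have : h^-1 *: (F (h + a) - F a) @[h --> 0^'] --> F^`()%classic a.
  apply: cvg_toP; last by [].
  by have := dF; rewrite /derivable; under eq_fun do rewrite /= [_%:A]mulr1.
move=> /cvgrPdist_lt/(_ e e0); rewrite -nbhs_nearE => /nbhs_ballP[d /= d0 H].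
exists d => // h h0 hd; rewrite distrC; apply: H => //=.
by rewrite /ball /= sub0r normrN.
Qed.

Lemma slope_derive1 (F : K^o -> K^o) (a l : K^o) :
  (forall e : K, 0 < e -> exists2 d : K, 0 < d & forall h, h != 0 -> `|h| < d ->
    `|h^-1 * (F (h + a) - F a) - l| < e) -> F^`()%classic a = l.
Proof.
move=> H; apply: cvg_lim => //.
apply/cvgrPdist_lt => e e0; have [d d0 {}H] := H e e0.
rewrite -nbhs_nearE; apply/nbhs_ballP; exists d => //= h.
rewrite /ball /= sub0r normrN => hd h0; rewrite distrC; exact: H.
Qed.

Lemma near_normP (a : K^o) (N : set K^o) :
  nbhs a N <-> exists2 d : K, 0 < d & forall z, `|z - a| < d -> N z.
Proof.
split=> [/nbhs_ballP[d /= d0 H]|[d d0 H]].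
  by exists d => // z zd; apply: H; rewrite /ball /= distrC.
by apply/nbhs_ballP; exists d => //= z; rewrite /ball /= distrC; exact: H.
Qed.

End NumFieldDerivative.

(** * Moduli, linear approximation and compactness in the complex plane *)

Section ComplexPlane.
Variable R : realType.
Local Notation C := (R[i]^o).
Implicit Types (a b z l : C) (F G : C -> C).

Lemma normc_norm (z : C) : `|z : R[i]| = (normc z)%:C%C. Proof. by case: z. Qed.

Lemma normc_ge0 (z : C) : 0 <= normc z.
Proof. by case: z => x y; exact: sqrtr_ge0. Qed.

Lemma normc_eq0 (z : C) : (normc z == 0) = (z == 0).
Proof. by apply/eqP/eqP => [/eq0_normc//|->]; exact: normc0. Qed.

Lemma normc_gt0 (z : C) : (0 < normc z) = (z != 0).
Proof. by rewrite lt_def normc_ge0 andbT normc_eq0. Qed.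

Lemma normc_distC (z a : C) : normc (z - a) = normc (a - z).
Proof. by rewrite -normcN opprB. Qed.

Lemma normc_tri (x y z : C) : normc (x - z) <= normc (x - y) + normc (y - z).
Proof. by rewrite -[x - z](subrKA y); exact: le_normcD. Qed.

Lemma normc_le_distD (x y : C) : normc x <= normc y + normc (x - y).
Proof. by rewrite -[X in normc X <= _](subrKC y); exact: le_normcD. Qed.

Lemma normcX (z : C) n : normc (z ^+ n) = normc z ^+ n.
Proof. by elim: n => [|n IH]; rewrite ?expr0 ?normc1 // !exprS normcM IH. Qed.

Lemma normc_real (x : R) : normc (x%:C%C) = `|x|.
Proof. by rewrite /normc /= expr0n /= addr0 sqrtr_sqr. Qed.

(** In the partial order of R[i] a positive element is real. This exchanges the radii and tolerances
    of the norm topology, which live in R[i], for real ones. *)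
Lemma pos_complexP (d : R[i]) : 0 < d -> exists2 r : R, 0 < r & d = r%:C%C.
Proof. by case: d => x y; rewrite ltcE /= => /andP[/eqP-> ?]; exists x. Qed.

Lemma nbhs_normcP a (N : set C) :
  nbhs a N <-> exists2 r : R, 0 < r & forall z, normc (z - a) < r -> N z.
Proof.
split=> [/near_normP[d /pos_complexP[r r0 ->] H]|[r r0 H]].
  by exists r => // z zr; apply: H; rewrite normc_norm ltcR.
apply/near_normP; exists r%:C%C; first by rewrite ltcR.
by move=> z; rewrite normc_norm ltcR; exact: H.
Qed.

(** The linear approximation form of the derivative: without a quotient, z = a is no special case,
    and the chain rule and changes of chart become plain estimates. *)
Definition cdiff F a l := forall e : R, 0 < e -> exists2 d : R, 0 < d &
  forall z, normc (z - a) < d ->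
    normc (F z - F a - l * (z - a)) <= e * normc (z - a).

Lemma derivable_cdiff F a : derivable F a 1 -> cdiff F a (F^`()%classic a).
Proof.
move=> dF e e0.
have [|d' /pos_complexP[d d0 ->] H] := @derivable_slope R[i] F a dF e%:C%C.
  by rewrite ltcR.
exists d => // z zd; have [->|za] := eqVneq z a.
  by rewrite !subrr mulr0 subr0 normc0 mulr0.
have za0 : z - a != 0 by rewrite subr_eq0.
have := H (z - a) za0; rewrite normc_norm ltcR => /(_ zd).
rewrite subrK normc_norm ltcR => /ltW He.
have -> : F z - F a - F^`()%classic a * (z - a) =
  ((z - a)^-1 * (F z - F a) - F^`()%classic a) * (z - a).
  by rewrite mulrBl mulrAC mulVf // mul1r.
by rewrite normcM ler_wpM2r ?normc_ge0.
Qed.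

Lemma cdiff_derive1 F a l : cdiff F a l -> F^`()%classic a = l.
Proof.
move=> dF; apply: (@slope_derive1 R[i] F a l) => _ /pos_complexP[e e0 ->].
have [d d0 H] := dF (e / 2) (divr_gt0 e0 (ltr0n _ 2)).
exists d%:C%C; first by rewrite ltcR.
move=> h h0; rewrite !normc_norm !ltcR => hd.
have := H (h + a); rewrite addrK => /(_ hd) {}H.
have -> : h^-1 * (F (h + a) - F a) - l = h^-1 * (F (h + a) - F a - l * h).
  by rewrite [RHS]mulrBr mulrCA mulVf // mulr1.
rewrite normcM normcV mulrC ltr_pdivrMr ?normc_gt0 //.
apply: (le_lt_trans H); rewrite ltr_pM2r ?normc_gt0 //.
by rewrite ltr_pdivrMr // ltr_pMr // ltr1n.
Qed.

Lemma cdiff_id a : cdiff id a 1.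
Proof.
move=> e e0; exists 1 => // z _.
by rewrite mul1r subrr normc0 mulr_ge0 ?normc_ge0 ?ltW.
Qed.

Lemma cdiff_near F G a l (d : R) : 0 < d ->
  (forall z, normc (z - a) < d -> F z = G z) -> cdiff F a l -> cdiff G a l.
Proof.
move=> d0 FG dF e e0; have [d' d'0 H] := dF e e0.
exists (Num.min d d'); first by rewrite lt_min d0.
move=> z; rewrite lt_min => /andP[zd zd']; rewrite -!FG //; first exact: H.
by rewrite subrr normc0.
Qed.

Lemma cdiff_lipschitz F a l : cdiff F a l -> exists2 d : R, 0 < d &
  forall z, normc (z - a) < d -> normc (F z - F a) <= (normc l + 1) * normc (z - a).
Proof.
move=> dF; have [d d0 H] := dF 1 ltr01; exists d => // z zd.
rewrite -[F z - F a](subrK (l * (z - a))).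
apply: (le_trans (le_normcD _ _)); rewrite normcM mulrDl addrC lerD2l.
exact: H.
Qed.

Lemma cdiff_comp F G a l l' :
  cdiff F a l -> cdiff G (F a) l' -> cdiff (G \o F) a (l' * l).
Proof.
move=> dF dG e e0; have [d1 d10 H1] := cdiff_lipschitz dF.
set c := normc l + 1; have c0 : 0 < c by rewrite ltr_wpDl ?normc_ge0.
set c' := normc l' + 1; have c'0 : 0 < c' by rewrite ltr_wpDl ?normc_ge0.
have e20 : 0 < e / 2 by rewrite divr_gt0.
have [d2 d20 H2] := dG (e / 2 / c) (divr_gt0 e20 c0).
have [d3 d30 H3] := dF (e / 2 / c') (divr_gt0 e20 c'0).
exists (Num.min (Num.min d1 (d2 / c)) d3).
  by rewrite !lt_min d10 d30 divr_gt0.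
move=> z; rewrite !lt_min => /andP[/andP[zd1 zd2] zd3].
set t := z - a in zd1 zd2 zd3 *.
have Fz : normc (F z - F a) <= c * normc t by exact: H1.
have /H2 {}H2 : normc (F z - F a) < d2.
  by apply: (le_lt_trans Fz); rewrite mulrC -ltr_pdivlMr.
have {}H3 := H3 z zd3.
rewrite /= -/t.
have -> : G (F z) - G (F a) - l' * l * t =
  (G (F z) - G (F a) - l' * (F z - F a)) + l' * (F z - F a - l * t).
  by rewrite [l' * (_ - l * t)]mulrBr addrA subrK mulrA.
apply: (le_trans (le_normcD _ _)).
rewrite [leRHS](_ : _ = e / 2 * normc t + e / 2 * normc t); last first.
  by rewrite -mulrDl -splitr.
apply: lerD.
  apply: (le_trans H2).
  rewrite (_ : e / 2 * normc t = e / 2 / c * (c * normc t)); last first.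
    by rewrite mulrA divfK ?gt_eqF.
  by rewrite ler_wpM2l // divr_ge0 // ltW.
rewrite normcM; apply: (@le_trans _ _ (c' * (e / 2 / c' * normc t))).
  by apply: ler_pM; rewrite ?normc_ge0 // lerDl.
by rewrite mulrA mulrCA divff ?gt_eqF // mulr1.
Qed.

Lemma cdiff_inv a : a != 0 -> cdiff (fun z : C => z^-1) a (- (a ^+ 2)^-1).
Proof.
move=> a0 e e0; have na : 0 < normc a by rewrite normc_gt0.
(* For |z| > |a| / 2 the remainder (z - a)^2 / (a^2 z) is at most 2 |z - a|^2 / |a|^3, whence the
   second radius. *)
exists (Num.min (normc a / 2) (e * normc a ^+ 3 / 2)).
  by rewrite lt_min !divr_gt0 // mulr_gt0 // exprn_gt0.
move=> z; rewrite lt_min => /andP[z1 z2].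
have nz : normc a / 2 < normc z.
  have := normc_le_distD a z; rewrite normc_distC => H.
  lra.
have nz0 : 0 < normc z by apply: lt_trans nz; rewrite divr_gt0.
have z0 : z != 0 by rewrite -normc_gt0.
have -> : z^-1 - a^-1 - - (a ^+ 2)^-1 * (z - a) = (z - a) ^+ 2 / (a ^+ 2 * z).
  by field; rewrite ?a0 ?z0.
rewrite normcM normcV normcX [normc (a ^+ 2 * z)]normcM normcX.
rewrite [normc (z - a) ^+ 2]expr2 -mulrA mulrC ler_wpM2r ?normc_ge0 //.
rewrite ler_pdivrMr ?mulr_gt0 ?exprn_gt0 //.
apply: (le_trans (ltW z2)).
rewrite ler_pdivrMr // -!mulrA ler_pM2l // exprSr -mulrA ler_pM2l ?exprn_gt0 //.
by rewrite ler_pM2l // ltW //; lra.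
Qed.

Definition cdisc a (r : R) : set C := [set z | normc (z - a) <= r].

Lemma complex_compact_box (r : R) : compact [set z : C | `|complex.Re z| <= r /\ `|complex.Im z| <= r].
Proof.
have -> : [set z : C | `|complex.Re z| <= r /\ `|complex.Im z| <= r] =
    (fun p : R * R => (Complex p.1 p.2 : C)) @` (`[- r, r] `*` `[- r, r]).
  apply/seteqP; split=> [[x y] /= [xr yr]|_ [[x y] /= [xr yr] <-]].
    by exists (x, y); rewrite //= !in_itv /= -!ler_norml.
  by rewrite /= !ler_norml; rewrite !in_itv /= in xr yr.
apply: continuous_compact; last by apply: compact_setX; exact: segment_compact.
apply: continuous_subspaceT => -[x y] N /nbhs_normcP[e e0 H].
apply/nbhs_ballP; exists (e / 2); first by rewrite /= divr_gt0.
move=> [x' y'] [/= xe ye]; apply: H => /=.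
rewrite /normc /=; rewrite -(@ltr_pXn2r _ 2) ?nnegrE ?sqrtr_ge0 ?ltW //.
rewrite sqr_sqrtr ?addr_ge0 ?sqr_ge0 //.
rewrite /ball /= in xe ye; rewrite distrC in xe; rewrite distrC in ye.
have sq (u c : R) : `|u| < c -> u ^+ 2 < c ^+ 2.
  move=> uc; rewrite -real_normK ?num_real // ltr_pXn2r ?nnegrE //.
  exact/ltW/(le_lt_trans _ uc).
have {}xe := sq _ _ xe; have {}ye := sq _ _ ye.
have e2 : 0 < e ^+ 2 by rewrite exprn_gt0.
have -> : e ^+ 2 = 2 * (e / 2) ^+ 2 + (e ^+ 2) / 2 by field.
lra.
Qed.

Lemma Re_le_normc (z : C) : `|complex.Re z| <= normc z.
Proof.
case: z => x y /=; rewrite -sqrtr_sqr ler_wsqrtr // lerDl; exact: sqr_ge0.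
Qed.

Lemma Im_le_normc (z : C) : `|complex.Im z| <= normc z.
Proof.
case: z => x y /=; rewrite -sqrtr_sqr ler_wsqrtr // lerDr; exact: sqr_ge0.
Qed.

Lemma normc_le_ReIm (z : C) : normc z <= `|complex.Re z| + `|complex.Im z|.
Proof.
case: z => x y /=; rewrite -(@ler_pXn2r _ 2) ?nnegrE ?sqrtr_ge0 ?addr_ge0 //.
rewrite sqr_sqrtr ?addr_ge0 ?sqr_ge0 // sqrrD !real_normK ?num_real //.
by rewrite -addrA lerD2l lerDr mulrn_wge0 // mulr_ge0.
Qed.

Lemma cdisc_closed a r : closed (cdisc a r).
Proof.
move=> z clz; rewrite /cdisc /= leNgt; apply/negP => rz.
have [|w [wr /= zw]] := clz [set w | normc (w - z) < normc (z - a) - r].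
  by apply/nbhs_normcP; exists (normc (z - a) - r); rewrite ?subr_gt0.
have := normc_tri z w a; rewrite [normc (z - w)]normc_distC.
rewrite /cdisc /= in wr; lra.
Qed.

Lemma cdisc_compact a r : compact (cdisc a r).
Proof.
have -> : cdisc a r = cdisc a r `&`
    [set z : C | `|complex.Re z| <= normc a + r /\ `|complex.Im z| <= normc a + r].
  apply/seteqP; split=> [z zr|z []//]; split=> //=.
  have : normc z <= normc a + r.
    by apply: (le_trans (normc_le_distD z a)); rewrite lerD2l.
  by move=> H; rewrite !(le_trans _ H) ?Re_le_normc ?Im_le_normc.
rewrite setIC; apply: compact_closedI; last exact: cdisc_closed.
exact: complex_compact_box.
Qed.

Lemma complex_locally_compact : locally_compact [set: C].
Proof.
move=> z _; rewrite withinET; exists (cdisc z 1); last split.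
- by apply/nbhs_normcP; exists 1 => // w /ltW.
- exact: cdisc_compact.
- exact: cdisc_closed.
Qed.

Lemma complex_hausdorff : hausdorff_space C.
Proof.
move=> z w zw; apply/eqP; rewrite eq_sym -subr_eq0 -normc_eq0; apply/eqP.
have [//|d0] := eqVneq (normc (w - z)) 0.
have {}d0 : 0 < normc (w - z) / 2 by rewrite divr_gt0 // lt_def normc_ge0 d0.
have [||x /= [xz xw]] := zw [set x | normc (x - z) < normc (w - z) / 2]
                  [set x | normc (x - w) < normc (w - z) / 2].
- by apply/nbhs_normcP; exists (normc (w - z) / 2).
- by apply/nbhs_normcP; exists (normc (w - z) / 2).
have := normc_tri w x z; rewrite [normc (w - x)]normc_distC; lra.
Qed.

End ComplexPlane.

(** * Charts of the sphere *)

Section Sphere.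
Variable R : realType.
Local Notation C := (R[i]^o).
Implicit Types (a b z l : C) (p q : sphere R) (f g : sphere R -> sphere R).

Lemma sphere_compact : compact [set: sphere R].
Proof. exact: one_point_compactification_compact. Qed.

Lemma sphere_hausdorff : hausdorff_space (sphere R).
Proof.
apply: one_point_compactification_hausdorff; first exact: complex_locally_compact.
exact: complex_hausdorff.
Qed.

Lemma nbhs_some a (N : set (sphere R)) : nbhs (Some a : sphere R) N <->
  exists2 r : R, 0 < r & forall z, normc (z - a) < r -> N (Some z).
Proof.
rewrite -(nbhs_normcP a (fun z => N (Some z))); split; exact.
Qed.

Lemma nbhs_none (N : set (sphere R)) : nbhs (None : sphere R) N <->
  N None /\ exists M : R, forall z, M < normc z -> N (Some z).
Proof.
split=> [[K [cK clK] H]|[N0 [M H]]].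
  split; first by apply: H; right.
  have : exists M : R, forall z, K z -> normc z <= M.
    have : compact (@normc R @` K).
      apply: continuous_compact => //; apply: continuous_subspaceT => z N' /nbhs_ballP[e /= e0 He].
      apply/nbhs_normcP; exists e => // w zw; apply: He; rewrite /ball /=.
      apply: le_lt_trans zw; rewrite ler_norml lerBrDl lerBlDl.
      have := normc_le_distD w z; have := normc_le_distD z w.
      rewrite (normc_distC z w); lra.
    move=> /compact_bounded[M [_ HM]]; exists (M + 1) => z Kz.
    apply: le_trans (ler_norm _) _; apply: HM; first by rewrite ltrDl.
    by exists z.
  move=> [M HM]; exists M => z Mz; apply: H; left; exists z => // /HM.
  by rewrite leNgt Mz.
exists (cdisc 0 M); first by split; [exact: cdisc_compact|exact: cdisc_closed].
move=> _ [[z + <-]|->//]; rewrite /cdisc /= subr0 => /negP; rewrite -ltNge.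
exact: H.
Qed.

Definition chart_dom p : set (sphere R) :=
  [set q | if p is Some _ then q <> None else q <> Some (0 : C)].

Lemma chart_dom_self p : chart_dom p p.
Proof. by case: p. Qed.

Lemma chartK p q : chart_dom p q -> chart_inv p (chart p q) = q.
Proof.
case: p q => [b|] [a|] //=; rewrite ?eqxx // => a0.
have -> : (a^-1 == 0 :> C) = false by rewrite invr_eq0; apply/eqP => E; apply: a0; rewrite E.
by rewrite invrK.
Qed.

Lemma chart_invK p z : chart p (chart_inv p z) = z.
Proof. by case: p => [b|] //=; case: eqP => [->|] //=; rewrite invrK. Qed.

Lemma chart_inv_dom p z : chart_dom p (chart_inv p z).
Proof.
case: p => [b|] //=; case: eqP => // /eqP z0 [] /eqP.
by rewrite invr_eq0 (negbTE z0).
Qed.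

(** Reduces every topological question on the sphere to discs in a chart. In the chart at infinity
    this is the continuity of inversion at nonzero points, and the exchange of |z| > M with |1/z| <
    1/M at infinity itself. *)
Lemma nbhs_chart p q (N : set (sphere R)) : chart_dom p q -> nbhs q N <->
  exists2 r : R, 0 < r & forall z, normc (z - chart p q) < r -> N (chart_inv p z).
Proof.
case: p q => [b|] [a|] //=; first by move=> _; exact: nbhs_some.
- move=> a0'; have a0 : a != 0 by apply/eqP => E; apply: a0'; rewrite E.
  have ai0 : a^-1 != 0 by rewrite invr_eq0.
  have inv_cont b e : b != 0 -> 0 < e -> exists2 d : R, 0 < d &
      forall z, normc (z - b) < d -> z != 0 /\ normc (z^-1 - b^-1) < e.
    move=> b0 e0; have nb : 0 < normc b by rewrite normc_gt0.
    have [d d0 H] := cdiff_lipschitz (cdiff_inv b0).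
    move: H; set L := _ + 1 => H.
    have L0 : 0 < L by rewrite ltr_wpDl ?normc_ge0.
    exists (Num.min (normc b) (Num.min d (e / L))).
      by rewrite !lt_min nb d0 divr_gt0.
    move=> z; rewrite !lt_min => /andP[zb /andP[zd ze]]; split.
      by apply/eqP => z0; move: zb; rewrite z0 sub0r normcN ltxx.
    by apply: (le_lt_trans (H z zd)); rewrite mulrC -ltr_pdivlMr.
  rewrite nbhs_some; split=> [[r r0 H]|[r r0 H]].
    have [d d0 Hd] := inv_cont _ _ ai0 r0; exists d => // z zd.
    have [z0 ze] := Hd z zd; rewrite (negbTE z0); apply: H.
    by rewrite invrK in ze.
  have [d d0 Hd] := inv_cont _ _ a0 r0; exists d => // z zd.
  have [z0 ze] := Hd z zd; have := H _ ze.
  by rewrite invr_eq0 (negbTE z0) invrK.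
- move=> _; rewrite nbhs_none; split=> [[N0 [M H]]|[r r0 H]].
    set M' := Num.max M 1; have M'0 : 0 < M' by rewrite lt_max ltr01 orbT.
    exists M'^-1; first by rewrite invr_gt0.
    move=> z; rewrite subr0; case: eqP => // /eqP z0 zM; apply: H.
    rewrite normcV; apply: (@le_lt_trans _ _ M'); first by rewrite le_max lexx.
    by rewrite -ltf_pV2 ?posrE ?invrK // invr_gt0 normc_gt0.
  split; first by have := H 0; rewrite subrr normc0 eqxx; exact.
  exists r^-1 => z zr.
  have z0 : z != 0.
    by rewrite -normc_gt0; apply: lt_trans zr; rewrite invr_gt0.
  have := H z^-1; rewrite invr_eq0 (negbTE z0) invrK subr0 normcV; apply.
  by rewrite -ltf_pV2 ?posrE ?invrK // invr_gt0 normc_gt0.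
Qed.

Lemma chart_dom_open p : open (chart_dom p).
Proof.
rewrite openE => q pq; apply/(nbhs_chart _ pq).
by exists 1 => // z _; exact: chart_inv_dom.
Qed.

Lemma chart_near p q (e : R) : chart_dom p q -> 0 < e ->
  \forall q' \near q, normc (chart p q' - chart p q) < e.
Proof.
move=> pq e0; apply/(nbhs_chart _ pq).
by exists e => // z ze; rewrite chart_invK.
Qed.

Lemma sphere_eq_chart p q q' : chart_dom p q -> chart_dom p q' ->
  chart p q = chart p q' -> q = q'.
Proof. by move=> pq pq' E; rewrite -(chartK pq) E chartK. Qed.

Definition chart_map p p' f : C -> C := chart p' \o f \o chart_inv p.

Lemma chart_map_comp p p' p'' f g q (l l' : C) : chart_dom p q ->
  chart_dom p' (f q) -> {for q, continuous f} ->
  cdiff (chart_map p p' f) (chart p q) l ->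
  cdiff (chart_map p' p'' g) (chart p' (f q)) l' ->
  cdiff (chart_map p p'' (g \o f)) (chart p q) (l' * l).
Proof.
move=> pq pfq cf df dg.
have [r r0 Hr] : exists2 r : R, 0 < r &
    forall z, normc (z - chart p q) < r -> chart_dom p' (f (chart_inv p z)).
  apply/(nbhs_chart (fun q => chart_dom p' (f q)) pq).
  by apply: cf; apply: open_nbhs_nbhs; split=> //; exact: chart_dom_open.
apply: (cdiff_near (F := chart_map p' p'' g \o chart_map p p' f) r0).
  by move=> z zr; rewrite /chart_map /= chartK //; exact: Hr.
by apply: cdiff_comp => //; rewrite /chart_map /= chartK.
Qed.

(** Twice the reciprocal of the density 2 / (1 + |a|^2) of the spherical metric. *)
Definition conformal (a : C) : R := 1 + normc a ^+ 2.

Lemma conformal_gt0 a : 0 < conformal a.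
Proof. by rewrite ltr_pwDl // sqr_ge0. Qed.

(** The map z -> 1/z is an isometry of the spherical metric: the modulus 1 / |z|^2 of its derivative
    is the ratio of the two conformal factors. *)
Lemma chart_change p p' q : chart_dom p q -> chart_dom p' q ->
  exists2 l, cdiff (chart_map p p' id) (chart p q) l &
    normc l * conformal (chart p q) = conformal (chart p' q).
Proof.
have same : (forall z, chart_map p p' id z = z) -> chart p q = chart p' q ->
   exists2 l, cdiff (chart_map p p' id) (chart p q) l &
     normc l * conformal (chart p q) = conformal (chart p' q).
  move=> H <-; exists 1; last by rewrite normc1 mul1r.
  apply: (cdiff_near (F := id) ltr01); last exact: cdiff_id.
  by move=> z _; rewrite H.
case: p p' same => [b|] [b'|] same //=.
- by move=> _ _; apply: same.
- case: q same => [a|] // same _ a0'.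
  have a0 : a != 0 by apply/eqP => E; apply: a0'; rewrite E.
  exists (- (a ^+ 2)^-1).
    by apply: (cdiff_near (F := fun z : C => z^-1) ltr01) => //; exact: cdiff_inv.
  have na : 0 < normc a by rewrite normc_gt0.
  rewrite normcN normcV normcX /conformal /= normcV.
  by field; rewrite gt_eqF.
- case: q same => [a|] // same a0' _.
  have a0 : a != 0 by apply/eqP => E; apply: a0'; rewrite E.
  have na : 0 < normc a by rewrite normc_gt0.
  exists (- ((a^-1) ^+ 2)^-1).
    apply: (cdiff_near (F := fun z : C => z^-1) (d := normc a^-1)) => //.
    + by rewrite normcV invr_gt0.
    + move=> z /= zd; rewrite /chart_map /=; case: eqP => // z0.
      by move: zd; rewrite z0 sub0r normcN ltxx.
    + by apply: cdiff_inv; rewrite invr_eq0.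
  rewrite normcN normcV normcX /conformal /= normcV.
  by field; rewrite gt_eqF.
- by move=> _ _; apply: same => // z; exact: (chart_invK None).
Qed.

(* s is |df(p)| for the spherical metric. *)
Definition sdiff f p (s : R) := {for p, continuous f} /\
  exists2 l, cdiff (chart_rep f p) (chart p p) l &
    s = normc l * conformal (chart p p) / conformal (chart (f p) (f p)).

Lemma chart_rep_self f p : chart_rep f p (chart p p) = chart (f p) (f p).
Proof. by rewrite /chart_rep /= chartK //; exact: chart_dom_self. Qed.

Lemma sdiff_sderiv f p s : sdiff f p s -> sderiv f p = s.
Proof.
move=> [_ [l dl ->]]; rewrite /sderiv (cdiff_derive1 dl).
by rewrite chart_rep_self.
Qed.

Lemma holomorphic_sdiff f p : {for p, continuous f} ->
  derivable (chart_rep f p) (chart p p) 1 -> sdiff f p (sderiv f p).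
Proof.
move=> cf /derivable_cdiff df; split=> //.
exists (derive1 (chart_rep f p) (chart p p)) => //.
by rewrite /sderiv chart_rep_self.
Qed.

Lemma sdiff_ge0 f p s : sdiff f p s -> 0 <= s.
Proof.
move=> [_ [l _ ->]].
by rewrite divr_ge0 ?mulr_ge0 ?normc_ge0 // ltW // conformal_gt0.
Qed.

(** Frees the spherical derivative from the charts centred at q and f q: a segment is followed in
    one fixed chart, and its image in another. *)
Lemma sdiff_chart f q s p p' : sdiff f q s -> chart_dom p q ->
  chart_dom p' (f q) -> exists2 l, cdiff (chart_map p p' f) (chart p q) l &
    normc l * conformal (chart p q) = s * conformal (chart p' (f q)).
Proof.
move=> [cf [l dl ->]] pq pfq.
have [l1 d1 e1] := chart_change pq (chart_dom_self q).
have [l2 d2 e2] := chart_change (chart_dom_self (f q)) pfq.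
exists (l2 * (l * l1)).
  have cid : {for q, continuous (id : sphere R -> sphere R)} by move=> N.
  have H := chart_map_comp (g := f) pq (chart_dom_self q) cid d1 dl.
  exact: (chart_map_comp (g := id) (f := f) pq (chart_dom_self (f q)) cf H d2).
have c2 := conformal_gt0 (chart (f q) (f q)).
rewrite !normcM -e2 -!mulrA e1; field; rewrite gt_eqF //.
Qed.

Lemma sdiff_comp f g p s s' : sdiff f p s -> sdiff g (f p) s' ->
  sdiff (g \o f) p (s' * s).
Proof.
move=> [cf [l dl ->]] [cg [l' dl' ->]]; split; first exact: continuous_comp.
exists (l' * l).
  exact: (chart_map_comp (chart_dom_self p) (chart_dom_self (f p)) cf dl dl').
have c1 := conformal_gt0 (chart (f p) (f p)).
have c2 := conformal_gt0 (chart (g (f p)) (g (f p))).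
by rewrite normcM; field; rewrite !gt_eqF.
Qed.

Lemma sdiff_near f g p s : (\forall q \near p, f q = g q) -> sdiff f p s ->
  sdiff g p s.
Proof.
move=> fg [cf [l dl ->]]; have fgp := nbhs_singleton fg.
split.
  move=> N; rewrite -fgp => /cf; rewrite !nbhs_simpl /= => fN.
  by apply: filterS2 fg fN => q /= <-.
exists l; last by rewrite fgp.
have [r r0 Hr] := (nbhs_chart _ (chart_dom_self p)).1 fg.
apply: (cdiff_near r0) dl => z /Hr zr.
by rewrite /chart_rep /= zr fgp.
Qed.

Lemma sdiff_id p : sdiff id p 1.
Proof.
split; first by move=> N.
have [l dl e] := chart_change (chart_dom_self p) (chart_dom_self p).
by exists l => //; rewrite e divff // gt_eqF // conformal_gt0.
Qed.

End Sphere.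

(** * Homotopy lifting *)

(** The supremum of the times up to which P holds is reached by the left-limit step, and the right
    step would pass it if it were below 1. *)
Lemma real_induction (R : realType) (P : R -> Prop) : P 0 ->
  (forall t, 0 <= t < 1 -> P t ->
    exists2 d, 0 < d & forall t', t < t' < t + d -> P t') ->
  (forall t, 0 < t <= 1 -> (forall t', 0 <= t' < t -> P t') -> P t) ->
  forall t, 0 <= t <= 1 -> P t.
Proof.
move=> P0 Pr Pl.
pose S : set R := [set t | 0 <= t <= 1 /\ forall t', 0 <= t' <= t -> P t'].
have S0 : S 0.
  split; first by rewrite lexx ler01.
  by move=> t' t'0; rewrite (_ : t' = 0) //; apply/eqP; rewrite eq_le andbC.
have Sub : ubound S 1 by move=> t [/andP[_ ?] _].
have Ssup : has_sup S by split; [exists 0|exists 1].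
set s := sup S.
have s0 : 0 <= s by apply: ub_le_sup => //; exists 1.
have s1 : s <= 1 by apply: ge_sup => //; exists 0.
have below t : 0 <= t < s -> P t.
  move=> /andP[t0 ts]; have st0 : 0 < s - t by rewrite subr_gt0.
  have [u [_ Pu]] := sup_adherent st0 Ssup; rewrite -/s subKr => tu.
  by apply: Pu; rewrite t0 ltW.
have Ps : P s.
  have [->//|sn0] := eqVneq s 0; apply: Pl => //.
  by rewrite lt_def sn0 s0.
have PS : S s.
  split; first by rewrite s0.
  move=> t /andP[t0]; rewrite le_eqVlt => /orP[/eqP->//|ts].
  by apply: below; rewrite t0.
suff -> : 1 = s by move=> t ?; exact: PS.2.
apply/eqP; rewrite eq_le s1 andbT leNgt; apply/negP => s_lt1.
have [|d d0 Hd] := Pr s _ Ps; first by rewrite s0.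
set u := Num.min (s + d / 2) 1.
have su : s < u by rewrite lt_min s_lt1 ltrDl divr_gt0.
suff : S u by move=> /(ub_le_sup (ex_intro _ 1 Sub)); rewrite leNgt su.
split; first by rewrite (le_trans s0 (ltW su)) /= ge_min lexx orbT.
move=> t /andP[t0 tu]; have [ts|st] := leP t s; first by apply: PS.2; rewrite t0.
apply: Hd; rewrite st /=; apply: (le_lt_trans tu).
by rewrite gt_min ltrD2l ltr_pdivrMr // ltr_pMr // ltr1n.
Qed.

Section HomotopyLifting.
Variables (R : realType) (X : topologicalType) (d : X -> X -> R).
Hypothesis d_sym : forall x y, d x y = d y x.
Hypothesis d_triangle : forall x y z, d x z <= d x y + d y z.
Hypothesis nbhs_d : forall x (N : set X),
  nbhs x N <-> exists2 r, 0 < r & forall y, d x y < r -> N y.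
Local Notation C := (R[i]^o).
(** E stands for the preimage of the closed disc of centre z0 and radius rho, p for the iterate read
    in the plane. Since E is cut off over the boundary circle, openness of p is asked only for
    targets y in the disc. *)
Variables (E : set X) (p : X -> C) (z0 : C) (rho : R).
Hypothesis E_compact : compact E.
Hypothesis p_continuous : forall e, E e -> forall r : R, 0 < r ->
  \forall e' \near e, normc (p e' - p e) < r.
Hypothesis p_open : forall e (N : set X), E e -> nbhs e N ->
  exists2 r : R, 0 < r & forall y, normc (y - z0) <= rho ->
    normc (y - p e) < r -> exists e', [/\ E e', N e' & p e' = y].
Hypothesis p_inj : forall e, E e -> exists2 N, nbhs e N &
  forall e' e'', E e' -> E e'' -> N e' -> N e'' -> p e' = p e'' -> e' = e''.

Lemma d_ball x r : 0 < r -> \forall y \near x, d x y < r.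
Proof. by move=> r0; apply/nbhs_d; exists r. Qed.

Lemma d_refl x r : 0 < r -> d x x < r.
Proof. by move=> r0; exact: nbhs_singleton (d_ball x r0). Qed.

(** A Lebesgue number argument: compactness, as near covering along the filter of s tending to 0
    from the right, merges the local thresholds into one. *)
Lemma compact_uniform (P : R -> X -> Prop) :
  (forall x, E x -> exists2 r : R, 0 < r &
     \forall y \near x, forall s, 0 < s < r -> P s y) ->
  exists2 s : R, 0 < s & forall x, E x -> P s x.
Proof.
move=> H; have /compact_near_coveringP K := E_compact.
have PF : Filter (0 : R)^'+ by exact: at_right_proper_filter.
have := K _ _ P PF; have : forall x, E x -> \forall x' \near x & i \near (0 : R)^'+, P i x'.
  move=> x /H[r r0 Hr].
  exists ([set y | forall s, 0 < s < r -> P s y], [set s | 0 < s < r]).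
    split => //=; near=> s; apply/andP; split; near: s.
      exact: nbhs_right_gt.
    exact: nbhs_right_lt.
  by move=> [y s] /= [Hy Hs]; exact: Hy.
move=> h /(_ h) {}h.
have [s [s0 Hs]] : exists s : R, 0 < s /\ E `<=` P s.
  apply: (@filter_ex _ (0 : R)^'+); near=> s; split.
    by near: s; exact: nbhs_right_gt.
  by near: s.
by exists s.
Unshelve. all: by end_near. Qed.

Lemma fibre_separation : exists2 k : R, 0 < k & forall e, E e ->
  forall e' e'', E e' -> E e'' -> d e e' < k -> d e e'' < k ->
    p e' = p e'' -> e' = e''.
Proof.
apply: (compact_uniform (P := fun k e => forall e' e'', E e' -> E e'' ->
  d e e' < k -> d e e'' < k -> p e' = p e'' -> e' = e'')) => e0 Ee0.
have [N /nbhs_d[r r0 Hr] NI] := p_inj Ee0.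
exists (r / 2); first by rewrite divr_gt0.
have := d_ball e0 (divr_gt0 r0 (ltr0n R 2)); apply: filterS => e ee0 s.
move=> /andP[s0 sr] e' e'' Ee' Ee'' h' h''; apply: NI => //; apply: Hr.
  by have := d_triangle e0 e e'; lra.
by have := d_triangle e0 e e''; lra.
Qed.

Lemma uniform_openness k : 0 < k -> exists2 h : R, 0 < h & forall e, E e ->
  forall y, normc (y - z0) <= rho -> normc (y - p e) < h ->
    exists e', [/\ E e', d e e' < k & p e' = y].
Proof.
move=> k0; apply: (compact_uniform (P := fun h e =>
  forall y, normc (y - z0) <= rho -> normc (y - p e) < h ->
    exists e', [/\ E e', d e e' < k & p e' = y])) => e0 Ee0.
have k20 : 0 < k / 2 by rewrite divr_gt0.
have [r r0 Hr] := p_open Ee0 (d_ball e0 k20).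
exists (r / 2); first by rewrite divr_gt0.
have := p_continuous Ee0 (divr_gt0 r0 (ltr0n R 2)).
apply: filterS2 (d_ball e0 k20) => e ee0 pe s /andP[s0 sr] y yz ys.
have [|e' [Ee' e0e' pe']] := Hr y yz.
  by have := normc_tri y (p e) (p e0); lra.
exists e'; split=> //.
by have := d_triangle e e0 e'; rewrite (d_sym e e0); lra.
Qed.

(* Contract the loop [p \o g] radially to z0 in steps so small that each
   step lifts uniquely; the lift of the constant loop is constant. *)
Lemma loop_lift (g : R -> X) : continuous g -> (forall t, E (g t)) ->
  (forall t, normc (p (g t) - z0) <= rho) ->
  p (g 0) = z0 -> p (g 1) = z0 -> g 0 = g 1.
Proof.
have [k k0 Hk] := fibre_separation.
have [h h0 Hh] := uniform_openness k0.
move=> cg gE grho g0 g1.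
have h20 : 0 < h / 2 by rewrite divr_gt0.
(* Induction on the number of units h / 2 needed to bound the distance from the image of the loop to
   z0. *)
have [n gn] : exists n : nat, forall t, normc (p (g t) - z0) <= n%:R * (h / 2).
  exists (Num.truncn (rho / (h / 2))).+1 => t; apply: (le_trans (grho t)).
  by rewrite -ler_pdivrMr // ltW // truncnS_gt.
elim: n => [|n IH] in g cg gE grho g0 g1 gn *.
  have pg t : p (g t) = z0.
    apply/eqP; rewrite -subr_eq0 -normc_eq0 eq_le normc_ge0 andbT.
    by have := gn t; rewrite mul0r.
  (* For n = 0 the whole path lies in the fibre over z0, which is discrete at scale k, so it is
     locally constant. *)
  have close t : \forall t' \near t, g t' = g t.
    have : \forall t' \near t, d (g t) (g t') < k by exact: (cg t _ (d_ball (g t) k0)).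
    apply: filterS => t' tt'; apply: (Hk (g t)); rewrite ?pg //.
    exact: d_refl.
  symmetry; apply: (real_induction (P := fun t => g t = g 0)) => //.
  - move=> t _ <-; have /nbhs_ballP[r /= r0 Hr] := close t; exists r => //.
    move=> t' /andP[tt' t'r]; apply: Hr; rewrite /ball /= ltr_distlC.
    by apply/andP; split; lra.
  - move=> t /andP[t0 t1] H; have /nbhs_ballP[r /= r0 Hr] := close t.
    set t' := Num.max 0 (t - r / 2).
    have r20 : 0 < r / 2 by rewrite divr_gt0.
    have tt' : t' < t by rewrite gt_max t0 /= ltrBlDr ltrDl.
    rewrite -(H t'); last by rewrite tt' le_max lexx.
    symmetry; apply: Hr; rewrite /ball /= ltr_distlC.
    have : t - r / 2 <= t' by rewrite le_max lexx orbT.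
    by move=> tt''; apply/andP; split; lra.
  - by rewrite ler01 lexx.
(* Scaling by n / (n + 1) turns the bound (n + 1) h / 2 into n h / 2 and moves each point by at most
   h / 2, within reach of uniform openness. *)
pose c : R := n%:R / n.+1%:R.
have c01 : 0 <= c <= 1.
  by rewrite divr_ge0 //= ler_pdivrMr ?ltr0n // mul1r ler_nat.
pose y t := z0 + c%:C%C * (p (g t) - z0).
have yz t : normc (y t - z0) = c * normc (p (g t) - z0).
  by rewrite /y addrC addKr normcM normc_real ger0_norm //; case/andP: c01.
have yrho t : normc (y t - z0) <= rho.
  rewrite yz; apply: le_trans (grho t); rewrite ler_piMl ?normc_ge0 //.
  by case/andP: c01.
have yp t : normc (y t - p (g t)) < h.
  have -> : y t - p (g t) = (c - 1)%:C%C * (p (g t) - z0).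
    by rewrite /y rmorphB /= rmorph1; ring.
  rewrite normcM normc_real ler0_norm; last by case/andP: c01; rewrite subr_le0.
  have -> : - (c - 1) = n.+1%:R^-1.
    by rewrite /c -natr1; field; rewrite natr1 pnatr_eq0.
  rewrite mulrC ltr_pdivrMr ?ltr0n //; apply: (le_lt_trans (gn t)).
  by rewrite mulrC ltr_pM2r ?ltr0n // ltr_pdivrMr // ltr_pMr // ltr1n.
have [g' Hg'] : exists g' : R -> X, forall t,
    [/\ E (g' t), d (g t) (g' t) < k & p (g' t) = y t].
  have Hy t : exists e', [/\ E e', d (g t) e' < k & p e' = y t] by exact: Hh.
  by have [f Hf] := boolp.choice Hy; exists f.
have g'E t : E (g' t) by case: (Hg' t).
have pg' t : p (g' t) = y t by case: (Hg' t).
have end_fixed t : p (g t) = z0 -> g' t = g t.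
  move=> gt; have [_ dg _] := Hg' t; apply: (Hk (g t)) => //; first exact: d_refl.
  by rewrite pg' /y gt subrr mulr0 addr0.
rewrite -(end_fixed 0) // -(end_fixed 1) //; apply: IH => //.
(* The values of g' are chosen pointwise; continuity follows from uniqueness. Openness of p at g' t
   gives a lift e of y t' close to g' t. The radius r is what makes e lie within k of g t', which
   forces e = g' t'. *)
- move=> t N; have [_ dg _] := Hg' t.
  set r := k - d (g t) (g' t); have r0 : 0 < r by rewrite subr_gt0.
  have r20 : 0 < r / 2 by rewrite divr_gt0.
  move=> tN.
  have [s s0 Hs] := p_open (g'E t) (filterI tN (d_ball (g' t) r20)).
  have : \forall t' \near t, normc (p (g t') - p (g t)) < s.
    exact: (cg t _ (p_continuous (gE t) s0)).
  have : \forall t' \near t, d (g t) (g t') < r / 2.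
    exact: (cg t _ (d_ball (g t) r20)).
  apply: filterS2 => t' dt' pt' /=.
  have [//||e [Ee [Ne de] pe]] := Hs (y t').
    rewrite pg'; apply: le_lt_trans pt'.
    have -> : y t' - y t = c%:C%C * (p (g t') - p (g t)).
      by rewrite /y; ring.
    rewrite normcM normc_real ger0_norm; last by case/andP: c01.
    by rewrite ler_piMl ?normc_ge0 //; case/andP: c01.
  have [_ dg' _] := Hg' t'.
  suff <- : e = g' t' by [].
  apply: (Hk (g t')) => //; last by rewrite pe pg'.
  have := d_triangle (g t') (g t) e; have := d_triangle (g t) (g' t) e.
  by rewrite (d_sym (g t') (g t)); rewrite /r in dt' de; lra.
- by move=> t; rewrite pg'.
- by rewrite end_fixed.
- by rewrite end_fixed.
- move=> t; rewrite pg' yz; apply: (@le_trans _ _ (c * (n.+1%:R * (h / 2)))).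
    by rewrite ler_wpM2l ?gn //; case/andP: c01.
  by rewrite mulrA /c divfK // pnatr_eq0.
Qed.

End HomotopyLifting.

(** * A metric on the sphere *)

Section SphereMetric.
Variable R : realType.
Local Notation C := (R[i]^o).
Implicit Types (p q x : sphere R).

(* Stereographic projection, up to an affine map. *)
Definition stereo_plane (q : sphere R) : C :=
  if q is Some z then z * ((conformal z)^-1)%:C%C else 0.
Definition stereo_height (q : sphere R) : R :=
  if q is Some z then (conformal z)^-1 else 0.

(** Comparable to the chordal distance. It only serves to describe the topology; derivatives are
    measured in charts. *)
Definition sphere_dist p q : R := normc (stereo_plane p - stereo_plane q) +
  `|stereo_height p - stereo_height q|.

Lemma sphere_dist_sym p q : sphere_dist p q = sphere_dist q p.
Proof. by rewrite /sphere_dist normc_distC distrC. Qed.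

Lemma sphere_dist_triangle p q x :
  sphere_dist p x <= sphere_dist p q + sphere_dist q x.
Proof.
rewrite /sphere_dist addrACA; apply: lerD; first exact: normc_tri.
exact: ler_distD.
Qed.

Lemma sphere_dist_ge0 p q : 0 <= sphere_dist p q.
Proof. by rewrite addr_ge0 ?normc_ge0. Qed.

Lemma sphere_dist_eq0 p q : sphere_dist p q = 0 -> p = q.
Proof.
move/eqP; rewrite /sphere_dist paddr_eq0 ?normc_ge0 // normc_eq0 normr_eq0.
rewrite !subr_eq0 => /andP[/eqP uE /eqP vE].
have c0 (z : C) : (conformal z)^-1 != 0 by rewrite invr_eq0 gt_eqF // conformal_gt0.
case: p q uE vE => [a|] [b|] //=; last 2 first.
- by move=> _ E; have := c0 a; rewrite E eqxx.
- by move=> _ E; have := c0 b; rewrite -E eqxx.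
move=> + E; rewrite E => /mulIf H; congr Some; apply: H.
by rewrite eq_complex /= negb_and c0.
Qed.

Lemma sphere_dist_near q (e : R) : 0 < e ->
  \forall q' \near q, sphere_dist q q' < e.
Proof.
move=> e0; case: q => [a|].
  have a2 : 0 < 2 + normc a by rewrite ltr_wpDr ?normc_ge0.
  (* Near a the height varies by at most |z - a| and the plane component by at most (1 + |a|) |z -
     a|. *)
  apply/nbhs_some; exists (e / (2 + normc a)); first by rewrite divr_gt0.
  move=> z; rewrite ltr_pdivlMr // => zd; apply: le_lt_trans zd.
  rewrite /sphere_dist /=; set va := _^-1; set vz := (conformal z)^-1.
  have ca := conformal_gt0 a; have cz := conformal_gt0 z.
  have H (t : R) : 0 <= t -> 2 * t <= 1 + t ^+ 2.
    by move=> _; have := sqr_ge0 (t - 1); nra.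
  have v_lip : `|va - vz| <= normc (z - a).
    have -> : va - vz = (normc z - normc a) * ((normc z + normc a) * (va * vz)).
      by rewrite /va /vz; move: ca cz; rewrite /conformal => ca cz; field; rewrite !gt_eqF.
    rewrite normrM.
    have : `|normc z - normc a| <= normc (z - a).
      rewrite ler_norml lerBrDl lerBlDl; apply/andP; split.
        by rewrite normc_distC; have := normc_le_distD a z; lra.
      by have := normc_le_distD z a; lra.
    move=> h; apply: (le_trans _ h); rewrite ler_piMr //.
    have na := normc_ge0 a; have nz := normc_ge0 z.
    rewrite ger0_norm; last by rewrite !mulr_ge0 ?addr_ge0 ?invr_ge0 // ltW.
    rewrite mulrA ler_pdivrMr // mul1r ler_pdivrMr //.
    have := H _ na; have := H _ nz; rewrite /conformal => h1 h2.
    have : 0 <= normc a ^+ 2 by rewrite sqr_ge0.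
    have : 0 <= normc z ^+ 2 by rewrite sqr_ge0.
    nra.
  have vz1 : 0 <= vz <= 1.
    by rewrite invr_ge0 ltW //= invf_le1 // lerDl sqr_ge0.
  have -> : a * va%:C%C - z * vz%:C%C = (a - z) * vz%:C%C + a * (va - vz)%:C%C.
    by rewrite rmorphB /=; ring.
  have h1 : normc ((a - z) * vz%:C%C) <= normc (z - a).
    rewrite normcM normc_real ger0_norm; last by case/andP: vz1.
    by rewrite normc_distC ler_piMr ?normc_ge0 //; case/andP: vz1.
  have h2 : normc (a * (va - vz)%:C%C) <= normc a * normc (z - a).
    by rewrite normcM normc_real ler_wpM2l ?normc_ge0.
  by have := le_normcD ((a - z) * vz%:C%C) (a * (va - vz)%:C%C); lra.
apply/nbhs_none; split.
  by rewrite /sphere_dist !subrr normc0 normr0 addr0.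
(* The distance from z to infinity is (1 + |z|) / (1 + |z|^2), at most 2 / |z|. *)
exists (2 / e) => z ze; rewrite /sphere_dist /= !sub0r normcN normrN normcM.
have nz : 0 < normc z by apply: lt_trans ze; rewrite divr_gt0.
have cz := conformal_gt0 z.
rewrite normc_real ger0_norm ?invr_ge0 ?ltW // -[X in _ + X]mul1r -mulrDl.
rewrite ltr_pdivrMr //; apply: (@le_lt_trans _ _ (2 / normc z * conformal z)).
  rewrite -[leRHS]mulrA [_^-1 * _]mulrC mulrA ler_pdivlMr // /conformal.
  by have := sqr_ge0 (normc z - 1); nra.
rewrite ltr_pM2r // ltr_pdivrMr // mulrC -ltr_pdivrMr //.
Qed.

(** Balls are small because on the compact complement of an open neighbourhood of x the distance to
    x attains a minimum, which is positive. *)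
Lemma nbhs_sphere_dist x (N : set (sphere R)) :
  nbhs x N <-> exists2 r : R, 0 < r & forall y, sphere_dist x y < r -> N y.
Proof.
split=> [|[r r0 H]]; last by apply: filterS (sphere_dist_near x r0).
rewrite nbhsE => -[V [oV Vx] VN].
have [NV|V0] := pselect (~` V !=set0); last first.
  by exists 1 => // y _; apply: VN; apply: contrapT => yV; apply: V0; exists y.
have cV : compact (~` V).
  apply: (subclosed_compact _ (@sphere_compact R)) => //.
  exact: open_closedC.
have [|c] := compact_EVT_min (f := sphere_dist x) NV cV.
  apply: continuous_subspaceT => y N' /nbhs_ballP[e /= e0 He].
  apply: filterS (sphere_dist_near y e0) => y' yy'; apply: He.
  rewrite /ball /= ltr_distlC.
  have := sphere_dist_triangle x y y'; have := sphere_dist_triangle x y' y.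
  by rewrite (sphere_dist_sym y' y) => h1 h2; apply/andP; split; lra.
rewrite inE => Vc Hc; exists (sphere_dist x c).
  rewrite lt_def sphere_dist_ge0 andbT; apply/eqP => /sphere_dist_eq0 xc.
  by apply: Vc; rewrite -xc.
move=> y xy; apply: VN; apply: contrapT => yV.
by have := Hc y; rewrite inE => /(_ yV); rewrite leNgt xy.
Qed.

End SphereMetric.

(** * Local homeomorphisms *)

Section LocalHomeomorphism.
Variable R : realType.
Local Notation C := (R[i]^o).
Implicit Types (f g : sphere R -> sphere R) (w : sphere R).

(** An open mapping argument by minimisation: |G - y| has a minimum on a closed disc about a, not on
    the boundary circle when y is close to G a. A nonzero derivative at the minimum allows a further
    decrease unless G takes the value y there. Continuity of the derivative does not enter. *)
Lemma sdiff_noncritical_open f w :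
  (\forall p \near w, exists2 s, s != 0 & sdiff f p s) ->
  forall N, nbhs w N -> nbhs (f w) (f @` N).
Proof.
move=> fw N wN.
have cf : {for w, continuous f} by have [s _ []] := nbhs_singleton fw.
have wdom := chart_dom_self w; set a := chart w w.
pose G := chart_map w (f w) f.
have [r r0 Hr] : exists2 r : R, 0 < r & forall z, normc (z - a) < r ->
   (exists2 s, s != 0 & sdiff f (chart_inv w z) s) /\ N (chart_inv w z) /\
   chart_dom (f w) (f (chart_inv w z)).
  apply/(nbhs_chart (fun p => (exists2 s, s != 0 & sdiff f p s) /\ N p /\
    chart_dom (f w) (f p)) wdom).
  have dN : \forall p \near w, chart_dom (f w) (f p).
    apply: cf; apply: open_nbhs_nbhs; split; first exact: chart_dom_open.
    exact: chart_dom_self.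
  by apply: filterS3 fw wN dN => q.
have dG z : normc (z - a) < r -> exists2 l, l != 0 & cdiff G z l.
  move=> /Hr [[s s0 ds] [_ fz]].
  have [l] := sdiff_chart ds (chart_inv_dom w z) fz.
  rewrite chart_invK => dl e; exists l => //; apply/eqP => l0.
  move: e; rewrite l0 normc0 mul0r => /esym/eqP.
  by rewrite mulf_eq0 (negbTE s0) gt_eqF ?conformal_gt0.
have aa : normc (a - a) < r by rewrite subrr normc0.
have [l0 l00 dl0] := dG a aa.
have nl0 : 0 < normc l0 by rewrite normc_gt0.
have [d d0 Hd] := dl0 (normc l0 / 2) (divr_gt0 nl0 (ltr0n R 2)).
pose r1 := Num.min (d / 2) (r / 2).
have r10 : 0 < r1 by rewrite lt_min !divr_gt0.
have r1d : r1 < d by rewrite gt_min ltr_pdivrMr // ltr_pMr // ltr1n.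
have r1r : r1 < r.
  by rewrite gt_min [r / 2 < r]ltr_pdivrMr // ltr_pMr // ltr1n // orbT.
(* On the circle of radius r1 the linear part has modulus |l0| r1 and the error is at most half of
   it, so G stays at distance 2 mu from G a. For y within mu of G a the centre then beats the
   circle. *)
pose mu := normc l0 * r1 / 4.
have mu0 : 0 < mu by rewrite !(divr_gt0, mulr_gt0).
have circle z : normc (z - a) = r1 -> 2 * mu <= normc (G z - G a).
  move=> zr; have := Hd z; rewrite zr => /(_ r1d) h.
  have := normc_le_distD (l0 * (z - a)) (G z - G a).
  rewrite normcM zr [normc (l0 * _ - _)]normc_distC /mu; lra.
have fwa : chart (f w) (f w) = G a by rewrite /G /chart_map /= chartK.
apply/(nbhs_chart _ (chart_dom_self (f w))); rewrite fwa.
exists mu => // y yG.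
have ne : cdisc a r1 !=set0 by exists a; rewrite /cdisc /= subrr normc0 ltW.
have [|z] := compact_EVT_min (f := fun z => normc (G z - y)) ne (@cdisc_compact R a r1).
  apply: continuous_in_subspaceT => z; rewrite inE => zr.
  move=> N' /nbhs_ballP[e /= e0 He].
  have [l _ dl] := dG z (le_lt_trans zr r1r).
  have [d1 d10 Hd1] := cdiff_lipschitz dl.
  set L := normc l + 1 in Hd1; have L0 : 0 < L by rewrite ltr_wpDl ?normc_ge0.
  apply/nbhs_normcP; exists (Num.min d1 (e / L)).
    by rewrite lt_min d10 divr_gt0.
  move=> z'; rewrite lt_min => /andP[z'1 z'2]; apply: He.
  rewrite /ball /= ltr_distlC.
  have : normc (G z' - G z) < e.
    by apply: (le_lt_trans (Hd1 _ z'1)); rewrite mulrC -ltr_pdivlMr.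
  have := normc_tri (G z') (G z) y; have := normc_tri (G z) (G z') y.
  by rewrite (normc_distC (G z) (G z')) => h1 h2 h3; apply/andP; split; lra.
rewrite inE => zr minz.
have za : normc (G z - y) <= normc (G a - y).
  by apply: minz; rewrite inE /cdisc /= subrr normc0 ltW.
have {}zr : normc (z - a) < r1.
  rewrite lt_neqAle zr andbT; apply/eqP => /circle.
  have := normc_tri (G z) y (G a).
  by rewrite normc_distC in yG; rewrite (normc_distC y (G a)); lra.
have zr' := lt_trans zr r1r.
have [_ [Nz fz]] := Hr z zr'.
have [Gzy|Gzy] := eqVneq (G z) y.
  exists (chart_inv w z) => //; apply: (sphere_eq_chart fz).
    exact: chart_inv_dom.
  by rewrite chart_invK -Gzy.
(* otherwise a small step in the direction (y - G z) / G'(z) decreases |G - y| *)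
exfalso; have [l l_neq0 dl] := dG z zr'.
have nl : 0 < normc l by rewrite normc_gt0.
have [d1 d10 Hd1] := dl (normc l / 2) (divr_gt0 nl (ltr0n R 2)).
set v := (y - G z) / l.
have v0 : v != 0 by rewrite mulf_neq0 ?invr_eq0 // subr_eq0 eq_sym.
have nv : 0 < normc v by rewrite normc_gt0.
pose h := Num.min 1 (Num.min (d1 / 2 / normc v) ((r1 - normc (z - a)) / normc v)).
have h0 : 0 < h by rewrite !lt_min ltr01 !divr_gt0 // subr_gt0.
have h1 : h <= 1 by rewrite ge_min lexx.
have hv1 : h * normc v < d1.
  rewrite -ltr_pdivlMr // !gt_min ltr_pM2r ?invr_gt0 //.
  by rewrite ltr_pdivrMr // ltr_pMr // ltr1n orbT.
have hv2 : h * normc v <= r1 - normc (z - a).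
  by rewrite -ler_pdivlMr // !ge_min lexx !orbT.
set z' := z + h%:C%C * v.
have z'z : z' - z = h%:C%C * v by rewrite /z' addrC addKr.
have nz'z : normc (z' - z) = h * normc v.
  by rewrite z'z normcM normc_real ger0_norm // ltW.
have z'r : normc (z' - a) <= r1.
  by have := normc_tri z' z a; rewrite nz'z; lra.
have {minz} := minz z'; rewrite inE => /(_ z'r); apply/negP; rewrite -ltNge.
have := Hd1 z'; rewrite nz'z => /(_ hv1).
have -> : l * (z' - z) = h%:C%C * (y - G z).
  by rewrite z'z /v; field.
set T := G z' - G z - _ => HT.
have -> : G z' - y = T + (1 - h)%:C%C * (G z - y).
  by rewrite /T rmorphB /=; ring.
apply: (le_lt_trans (le_normcD _ _)); rewrite normcM normc_real ger0_norm ?subr_ge0 //.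
have nvE : normc v * normc l = normc (G z - y).
  by rewrite -normcM /v divfK // normc_distC.
have : 0 < h * normc (G z - y) by rewrite mulr_gt0 // normc_gt0 subr_eq0.
by rewrite -nvE; lra.
Qed.

Definition local_homeo f w := [/\ {for w, continuous f},
  forall N, nbhs w N -> nbhs (f w) (f @` N) &
  exists2 N, nbhs w N & forall q q', N q -> N q' -> f q = f q' -> q = q'].

Lemma local_homeo_comp f g w : local_homeo f w -> local_homeo g (f w) ->
  local_homeo (g \o f) w.
Proof.
move=> [cf of_ [N wN fI]] [cg og [N' wN' gI]]; split.
- exact: continuous_comp.
- by move=> M /of_ /og; rewrite image_comp.
- exists (N `&` (f @^-1` N')); first by apply: filterI => //; exact: cf.
  by move=> q q' [Nq N'q] [Nq' N'q'] /gI /fI; exact.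
Qed.

Lemma local_homeo_id w : local_homeo id w.
Proof.
split; first by move=> N.
  by move=> N; rewrite image_id.
by exists setT => //; exact: filterT.
Qed.

Lemma filter_seq (T : eqType) (I : Type) (F : set_system I) (s : seq T)
    (P : T -> set I) : Filter F -> (forall x, x \in s -> F (P x)) ->
  F [set i | forall x, x \in s -> P x i].
Proof.
move=> FF; elim: s => [|x s IH] H; first by apply: filterS filterT.
have Fx := H x (mem_head x s).
have Fs : F [set i | forall x, x \in s -> P x i].
  by apply: IH => y ys; apply: H; rewrite inE ys orbT.
apply: filterS2 Fx Fs => i Pi Hi y.
by rewrite inE => /orP[/eqP->|]; [|exact: Hi].
Qed.

Lemma seq_separation (s : seq (sphere R)) : exists2 k : R, 0 < k &
  forall x x', x \in s -> x' \in s -> sphere_dist x x' < k -> x = x'.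
Proof.
pose P (x : sphere R * sphere R) : set R :=
  [set k | sphere_dist x.1 x.2 < k -> x.1 = x.2].
have : \forall k \near (0 : R)^'+, forall x, x \in allpairs pair s s -> P x k.
  apply: filter_seq => -[x x'] _ /=.
  have [<-|xx'] := eqVneq x x'; first by apply: nearW => k _.
  have d0 : 0 < sphere_dist x x'.
    rewrite lt_def sphere_dist_ge0 andbT; apply/eqP => /sphere_dist_eq0 E.
    by rewrite E eqxx in xx'.
  near=> k => xk; exfalso; move: xk; apply/negP; rewrite -leNgt; near: k.
  exact: nbhs_right_le.
move=> H; have [k [k0 Hk]] : exists k : R, 0 < k /\
    forall x, x \in allpairs pair s s -> P x k.
  apply: (@filter_ex _ (0 : R)^'+); apply: filterS2 (nbhs_right_gt 0) H.
  by move=> k.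
exists k => // x x' xs x's; apply: (Hk (x, x')).
by apply/allpairsP; exists (x, x').
Unshelve. all: by end_near. Qed.

(* Constant finite fibre size plus openness forces local injectivity: two
   nearby points of a fibre would make it larger than the central one. *)
Lemma constant_fibre_local_inj f (U W : set (sphere R)) (n : nat) w :
  open U -> U w -> {for w, continuous f} -> nbhs (f w) W ->
  (forall z, W z -> exists s : seq (sphere R),
     [/\ uniq s, [set` s] = U `&` f @^-1` [set z] & size s = n]) ->
  (forall x N, U x -> f x = f w -> nbhs x N -> nbhs (f w) (f @` N)) ->
  exists2 N, nbhs w N & forall q q', N q -> N q' -> f q = f q' -> q = q'.
Proof.
move=> oU Uw cf wW fibre fopen.
have [s [us sE sn]] := fibre _ (nbhs_singleton wW).
have memsP x : x \in s <-> U x /\ f x = f w.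
  have -> : (x \in s : Prop) = [set` s] x by [].
  by rewrite sE.
have [k k0 Hk] := seq_separation s.
have k20 : 0 < k / 2 by rewrite divr_gt0.
pose B (x : sphere R) := [set y | sphere_dist x y < k / 2] `&` U.
have Bn x : x \in s -> nbhs x (B x).
  move=> /memsP[Ux _]; apply: filterI; first exact: sphere_dist_near.
  by apply: open_nbhs_nbhs.
have Wn : nbhs (f w) [set z | forall x, x \in s -> (f @` B x) z].
  apply: filter_seq => x xs; have [Ux fx] := (memsP x).1 xs.
  exact: (fopen x _ Ux fx (Bn x xs)).
have ws : w \in s by apply/memsP.
exists (B w `&` f @^-1` ([set z | forall x, x \in s -> (f @` B x) z] `&` W)).
  apply: filterI; first exact: Bn.
  by apply: cf; exact: filterI.
move=> q q' [[wq Uq] [fq Wq]] [[wq' Uq'] _] qq'; apply: contrapT => neq.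
have [s' [us' s'E s'n]] := fibre _ Wq.
have mems'P x : x \in s' <-> U x /\ f x = f q.
  have -> : (x \in s' : Prop) = [set` s'] x by [].
  by rewrite s'E.
(* To each point x of the central fibre corresponds a point of the fibre of f q in the ball about x,
   with q itself assigned to w. The balls are disjoint, so q' is an additional point. *)
have Hex x : exists y, x \in s -> [/\ B x y, f y = f q & (x = w -> y = q)].
  have [->|xw] := eqVneq x w; first by exists q.
  have [xs|xs] := boolP (x \in s); last by exists q.
  have [y By fy] := fq x xs; exists y => _; split=> // E.
  by rewrite E eqxx in xw.
have [h Hh] := boolp.choice Hex.
have sub x y y' : x \in s -> y \in s -> B x y' -> B y y' -> x = y.
  move=> xs ys [h1 _] [h2 _]; apply: Hk => //.
  have := sphere_dist_triangle x y' y; rewrite (sphere_dist_sym y' y).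
  by rewrite /= in h1 h2; lra.
have uq : uniq (q' :: map h s).
  rewrite /= map_inj_in_uniq ?us ?andbT; last first.
    move=> x y xs ys E; have [Bx _ _] := Hh x xs; have [By _ _] := Hh y ys.
    by apply: (sub x y (h x)) => //; rewrite E.
  apply/negP => /mapP[x xs E]; have [Bx _ hx] := Hh x xs.
  have xw : x = w by apply: (sub x w q') => //; rewrite E.
  by apply: neq; rewrite E hx.
have /(uniq_leq_size uq) : {subset q' :: map h s <= s'}.
  move=> x; rewrite inE => /orP[/eqP->|/mapP[y ys ->]]; apply/mems'P => //.
  by have [[_ ?] ? _] := Hh y ys.
by rewrite /= size_map sn s'n ltnn.
Qed.

End LocalHomeomorphism.

(** * Packing in the plane *)

Section Packing.
Variables (R : realType) (T : eqType).
Local Notation C := (R[i]^o).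
Variables (a : T -> C) (r : T -> R) (B : R).
Hypothesis B0 : 0 < B.

Lemma truncn_dist (u v : R) : 0 <= u -> 0 <= v ->
  Num.truncn u = Num.truncn v -> `|u - v| < 1.
Proof.
move=> u0 v0 E; have /andP[h1 h2] := truncn_itv u0.
have /andP[h3 h4] := truncn_itv v0.
rewrite E in h1 h2; rewrite -natr1 in h2 h4.
by rewrite ltr_norml; apply/andP; split; lra.
Qed.

(** Pigeonhole on a grid of mesh e / 2: two points of one cell are less than e apart. With N cells
    per side, N e <= 4 B + e <= 6 B, whence 36. *)
Lemma separated_size (s : seq T) (e : R) : uniq s -> 0 < e <= 2 * B ->
  (forall x, x \in s -> normc (a x) <= B) ->
  (forall x y, x \in s -> y \in s -> x != y -> e <= normc (a x - a y)) ->
  (size s)%:R * e ^+ 2 <= 36 * B ^+ 2.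
Proof.
move=> us /andP[e0 e2B] aB sep; set h := e / 2.
have h0 : 0 < h by rewrite divr_gt0.
pose N := (Num.truncn (2 * B / h)).+1.
have bounds (t : R) : `|t| <= B -> 0 <= (t + B) / h /\ (t + B) / h <= 2 * B / h.
  rewrite ler_norml => /andP[t1 t2]; split; first by apply: divr_ge0; [lra|exact: ltW].
  by rewrite ler_pM2r ?invr_gt0 //; lra.
pose cell (t : R) : 'I_N := inord (Num.truncn ((t + B) / h)).
have cellP (t t' : R) : `|t| <= B -> `|t'| <= B -> cell t = cell t' -> `|t - t'| < h.
  move=> /bounds[t0 t1] /bounds[t'0 t'1] /(congr1 val).
  rewrite /= !inordK ?ltnS ?le_truncn // => /(truncn_dist t0 t'0).
  rewrite -mulrBl opprD addrACA subrr addr0 normrM [`|h^-1|]gtr0_norm ?invr_gt0 //.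
  by rewrite ltr_pdivrMr // mul1r.
pose c x := (cell (complex.Re (a x)), cell (complex.Im (a x))).
have cI : {in s &, injective c}.
  move=> x y xs ys [c1 c2]; apply/eqP; apply: contraT => /(sep _ _ xs ys).
  have bd x' (x's : x' \in s) := aB x' x's.
  have h1 := cellP _ _ (le_trans (Re_le_normc _) (bd x xs)) (le_trans (Re_le_normc _) (bd y ys)) c1.
  have h2 := cellP _ _ (le_trans (Im_le_normc _) (bd x xs)) (le_trans (Im_le_normc _) (bd y ys)) c2.
  have ReB (z w : C) : complex.Re (z - w) = complex.Re z - complex.Re w.
    by case: z w => [? ?] [].
  have ImB (z w : C) : complex.Im (z - w) = complex.Im z - complex.Im w.
    by case: z w => [? ?] [].
  have := normc_le_ReIm (a x - a y); rewrite ReB ImB /h in h1 h2 *; lra.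
have /leq_trans H : (size s <= #|{: 'I_N * 'I_N}|)%N.
  rewrite -(size_map c s) cardE; apply: uniq_leq_size.
    by rewrite map_inj_in_uniq.
  by move=> x _; rewrite mem_enum.
have {H} : (size s <= N * N)%N by apply: H; rewrite card_prod card_ord.
rewrite -(ler_nat R) natrM => nN.
have Ne : N%:R * e <= 6 * B.
  have B2 : 0 <= 2 * B / h by rewrite divr_ge0 ?ltW // mulr_gt0.
  have /andP[H _] := truncn_itv B2; rewrite -(ler_pM2r e0) in H.
  have E : 2 * B / h * e = 4 * B by rewrite /h; field; rewrite gt_eqF.
  by rewrite E in H; rewrite /N -natr1 mulrDl mul1r; lra.
apply: (@le_trans _ _ ((N%:R * N%:R) * e ^+ 2)).
  by rewrite ler_wpM2r // sqr_ge0.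
have -> : N%:R * N%:R * e ^+ 2 = (N%:R * e) ^+ 2 by ring.
have -> : 36 * B ^+ 2 = (6 * B) ^+ 2 by ring.
by rewrite ler_pXn2r ?nnegrE // ?mulr_ge0 // ltW.
Qed.

Lemma seq_argmin (s : seq T) : s != [::] ->
  exists2 x, x \in s & forall y, y \in s -> r x <= r y.
Proof.
elim: s => // x s IH _; have [->|/IH[y ys ymin]] := eqVneq s [::].
  by exists x; rewrite ?mem_head // => y; rewrite inE => /eqP->.
have [xy|yx] := leP (r x) (r y).
  exists x; first exact: mem_head.
  by move=> z; rewrite inE => /orP[/eqP->//|/ymin]; exact: le_trans.
exists y; first by rewrite inE ys orbT.
by move=> z; rewrite inE => /orP[/eqP->|/ymin//]; exact: ltW.
Qed.

(* Removing the smallest radius first, the n-th largest one is at most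
   a constant times n ^ (-1/2), so that the fourth powers are summable. *)
Lemma packing_sum (s : seq T) : uniq s ->
  (forall x, x \in s -> normc (a x) <= B) ->
  (forall x, x \in s -> 0 < r x <= 2 * B) ->
  (forall x y, x \in s -> y \in s -> x != y -> r x <= normc (a x - a y)) ->
  \sum_(x <- s) r x ^+ 4 <= 2 * (36 * B ^+ 2) ^+ 2.
Proof.
set K := 36 * B ^+ 2; have K0 : 0 < K by rewrite mulr_gt0 // exprn_gt0.
have K20 : 0 < K ^+ 2 by rewrite exprn_gt0.
move=> us aB rB sep.
have [->|s0] := eqVneq s [::]; first by rewrite big_nil mulr_ge0 // ltW.
(* The term -1/n makes the induction close: the new term is at most K^2 / p^2 for p points, and
   1/p^2 <= 1/(p - 1) - 1/p telescopes. *)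
suff H : \sum_(x <- s) r x ^+ 4 <= K ^+ 2 * (2 - (size s)%:R^-1).
  apply: (le_trans H); rewrite mulrBr mulrC lerBlDr lerDl.
  by rewrite mulr_ge0 ?invr_ge0 // ltW.
have [n sn] : exists n, size s = n.+1 by case: (s) s0 => // x s' _; exists (size s').
elim: n s us aB rB sep s0 sn => [|n IH] s us aB rB sep s0 sn;
  have [x xs xmin] := seq_argmin s0;
  have rx : (size s)%:R * r x ^+ 2 <= K;
    try by (apply: separated_size => //; [exact: rB|];
    move=> y z ys zs yz; apply: le_trans (sep _ _ ys zs yz); exact: xmin).
all: rewrite (perm_big _ (perm_to_rem xs)) big_cons sn /=.
all: rewrite sn in rx.
- have -> : rem x s = [::] by apply: size0nil; rewrite size_rem // sn.
  rewrite big_nil addr0 invr1; rewrite mul1r in rx.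
  have -> : r x ^+ 4 = (r x ^+ 2) ^+ 2 by ring.
  have -> : K ^+ 2 * (2 - 1) = K ^+ 2 by ring.
  by rewrite ler_pXn2r ?nnegrE // ?sqr_ge0 // ltW.
set s' := rem x s; have us' : uniq s' by exact: rem_uniq.
have ss' y : y \in s' -> y \in s by exact: mem_rem.
have sn' : size s' = n.+1 by rewrite size_rem // sn.
have := IH s' us'; rewrite sn' => {}IH.
have {}IH : \sum_(y <- s') r y ^+ 4 <= K ^+ 2 * (2 - (n.+1)%:R^-1).
  apply: IH => //.
  - by move=> y /ss' /aB.
  - by move=> y /ss' /rB.
  - by move=> y z /ss' ys /ss' zs; exact: sep.
  - by rewrite -size_eq0 sn'.
set p : R := n.+2%:R in rx *; have p2 : 1 < p by rewrite ltr1n.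
have pE : n.+1%:R = p - 1 :> R by rewrite /p -[n.+2%:R]natr1 addrK.
rewrite pE in IH.
have p0 : 0 < p by lra.
have p10 : 0 < p - 1 by lra.
have rx4 : r x ^+ 4 <= K ^+ 2 * (p^-1 * p^-1).
  have : r x ^+ 2 <= K / p by rewrite ler_pdivlMr // mulrC.
  move=> h; have -> : r x ^+ 4 = (r x ^+ 2) ^+ 2 by ring.
  have -> : K ^+ 2 * (p^-1 * p^-1) = (K / p) ^+ 2 by ring.
  by rewrite ler_pXn2r ?nnegrE // ?sqr_ge0 // divr_ge0 // ltW.
have : p^-1 * p^-1 <= (p - 1)^-1 - p^-1.
  have -> : (p - 1)^-1 - p^-1 = p^-1 * (p - 1)^-1 by field; rewrite !gt_eqF.
  by rewrite ler_pM2l ?invr_gt0 // lef_pV2 ?posrE // lerBlDr lerDl.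
move=> h; rewrite -(ler_pM2l K20) mulrBr in h; move: h IH rx4; rewrite !mulrBr.
move=> h1 h2 h3; apply: (le_trans (lerD (le_trans h3 h1) h2)).
by rewrite [leLHS](_ : _ = K ^+ 2 * 2 - K ^+ 2 / p) //; ring.
Qed.

End Packing.

(** * Perron--Frobenius *)

Section Perron.
Variables (R : realType) (m : nat).
Implicit Types (A B : 'M[R]_m) (x y u v : 'rV[R]_m).

Definition irreducible_mx A := (forall i j, 0 <= A i j) /\
  forall i j, connect (fun i j => 0 < A i j) i j.

Lemma mulmx_ge0 p q r (M : 'M[R]_(p, q)) (N : 'M[R]_(q, r)) :
  (forall i j, 0 <= M i j) -> (forall i j, 0 <= N i j) ->
  forall i j, 0 <= (M *m N) i j.
Proof. by move=> M0 N0 i j; rewrite mxE sumr_ge0 // => k _; rewrite mulr_ge0. Qed.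

Lemma mulmx_gt0 p q r (M : 'M[R]_(p, q)) (N : 'M[R]_(q, r)) i j k :
  (forall i j, 0 <= M i j) -> (forall i j, 0 <= N i j) ->
  0 < M i k -> 0 < N k j -> 0 < (M *m N) i j.
Proof.
move=> M0 N0 Mk Nk; rewrite mxE (bigD1 k) //= ltr_pwDl ?mulr_gt0 //.
by rewrite sumr_ge0 // => l _; rewrite mulr_ge0.
Qed.

(** B is (1 + A)^m: the identity preserves entries that are already positive, and a path without
    repetition has fewer than m edges. *)
Lemma irreducible_commuting_positive A : irreducible_mx A ->
  exists2 B : 'M[R]_m, (forall i j, 0 < B i j) & A *m B = B *m A.
Proof.
move=> [A0 Ac]; pose P k := iter k (mulmx^~ (1%:M + A)) (1%:M : 'M[R]_m).
have I0 i j : 0 <= (1%:M + A) i j by rewrite !mxE addr_ge0 // mulrn_wge0.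
have P0 k i j : 0 <= P k i j.
  elim: k i j => [|k IH] i j; first by rewrite mxE mulrn_wge0.
  by rewrite /= mulmx_ge0.
have PS k i j : 0 < P k i j -> 0 < P k.+1 i j.
  move=> h; apply: (mulmx_gt0 (k := j)) => //.
  by rewrite !mxE eqxx ltr_pwDl.
have Pext k l i j : (k <= l)%N -> 0 < P k i j -> 0 < P l i j.
  by move=> /subnKC <-; elim: (l - k)%N => [|n IH] h; rewrite ?addn0 // addnS PS ?IH.
exists (P m) => [i j|]; last first.
  have comm k : A *m P k = P k *m A; last exact: comm.
  elim: k => [|k IH]; first by rewrite mulmx1 mul1mx.
  by rewrite [P k.+1]/= mulmxA IH -!mulmxA mulmxDr mulmxDl mulmx1 mul1mx.
have /connectP[s ps ->] := Ac i j.
have [s' ps' us' _] := shortenP ps.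
apply: (Pext (size s')).
  have := max_card [in i :: s']; rewrite (card_uniqP us') card_ord /=.
  exact: ltnW.
clear ps us' s; elim/last_ind: s' ps' => [|s' k IH].
  by move=> _; rewrite mxE eqxx ltr01.
rewrite rcons_path last_rcons size_rcons => /andP[/IH h1 h2].
apply: (mulmx_gt0 (k := last i s')) => //.
by rewrite !mxE ltr_wpDl // mulrn_wge0.
Qed.

Lemma continuous_lincomb (T : topologicalType) (I : Type) (s : seq I)
    (f : I -> T -> R) (c : I -> R) :
  (forall i, continuous (f i)) -> continuous (fun t => \sum_(i <- s) f i t * c i).
Proof.
move=> cf; elim: s => [|k s IH].
  rewrite (_ : (fun _ => _) = cst 0); first exact: cst_continuous.
  by apply/funext => t; rewrite big_nil.
rewrite (_ : (fun _ => _) = (fun t => f k t * c k + \sum_(i <- s) f i t * c i)); last first.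
  by apply/funext => t; rewrite big_cons.
move=> x; apply: cvgD; last exact: IH.
by apply: cvgM; [exact: cf|exact: cvg_cst].
Qed.

Lemma linear_form_continuous (c : 'I_m -> R) :
  continuous (fun x : 'rV[R]_m => \sum_k x 0 k * c k).
Proof.
by apply: (continuous_lincomb (f := fun k (x : 'rV[R]_m) => x 0 k)) => k; exact: coord_continuous.
Qed.

Lemma row_subZ (u v : 'rV[R]_m) l i : (u - l *: v) 0 i = u 0 i - l * v 0 i.
Proof. by rewrite !mxE. Qed.

(** The Collatz-Wielandt argument: take the largest l with l u <= u A for some u = x B, x in the
    simplex. The factor B keeps u positive while x ranges over a compact set. If equality failed in
    one coordinate, a further multiplication by B would make all of them strict, and l could be
    raised. *)
Lemma perron_left A : (0 < m)%N -> irreducible_mx A ->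
  exists (l : R) x, [/\ 0 <= l, forall i, 0 < x 0 i & x *m A = l *: x].
Proof.
move=> m0 Airr; have [A0 _] := Airr.
have [B B0 AB] := irreducible_commuting_positive Airr.
(* Summing the coordinates of l u <= u A shows that l is at most the sum of all entries. *)
pose L := \sum_i \sum_j A i j.
pose simplex := [set x : 'rV[R]_m | (forall i, 0 <= x 0 i <= 1) /\ \sum_i x 0 i = 1].
pose K := [set z : R * 'rV[R]_m | [/\ 0 <= z.1 <= L, simplex z.2 &
   forall i, z.1 * (z.2 *m B) 0 i <= (z.2 *m B *m A) 0 i]].
have posB x : (forall i, 0 <= x 0 i) -> (exists i, 0 < x 0 i) ->
    forall i, 0 < (x *m B) 0 i.
  move=> x0 [k xk] i; apply: (mulmx_gt0 (k := k)) => //.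
  - by move=> a b; rewrite (ord1 a).
  - by move=> a b; exact: ltW.
have simplex_pos x : simplex x -> exists i, 0 < x 0 i.
  move=> [x01 x1]; apply: contrapT => /forallNP h.
  have : \sum_i x 0 i <= 0.
    by apply: sumr_le0 => i _; rewrite leNgt; apply/negP/h.
  by rewrite x1 ler10.
have bound l x : simplex x -> (forall i, l * (x *m B) 0 i <= (x *m B *m A) 0 i) -> l <= L.
  move=> sx H; have xB := posB x (fun i => (andP (sx.1 i)).1) (simplex_pos x sx).
  set u := x *m B in H xB.
  have u0 : 0 < \sum_i u 0 i.
    rewrite (bigD1 (Ordinal m0)) //= ltr_pwDl // sumr_ge0 // => i _; exact: ltW.
  rewrite -(ler_pM2r u0) mulr_sumr (le_trans (ler_sum _ (fun i _ => H i))) //.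
  under eq_bigr do rewrite mxE.
  rewrite exchange_big /= mulr_sumr ler_sum // => i _.
  rewrite -mulr_sumr mulrC; apply: ler_wpM2r; first exact/ltW/xB.
  rewrite /L [leRHS](bigD1 i) //= lerDl.
  by apply: sumr_ge0 => k _; apply: sumr_ge0.
have Kc : compact K.
  pose cube := [set v : 'rV[R]_m | forall i, `[0, 1]%classic (v ord0 i)].
  have cc : compact (`[0, L]%classic `*` cube).
    apply: compact_setX; first exact: segment_compact.
    exact: (@rV_compact R m (fun=> `[0, 1]%classic) (fun _ => @segment_compact R 0 1)).
  apply: (subclosed_compact _ cc); last first.
    move=> [l x] [/= l0 [x0 _] _]; split; first by rewrite /= in_itv.
    by move=> i; rewrite /= in_itv; exact: x0.
  have -> : K = [set z : R * 'rV[R]_m | 0 <= z.1] `&` [set z : R * 'rV[R]_m | z.1 <= L] `&`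
     (\bigcap_(i in [set: 'I_m]) [set z : R * 'rV[R]_m | 0 <= z.2 0 i]) `&`
     (\bigcap_(i in [set: 'I_m]) [set z : R * 'rV[R]_m | z.2 0 i <= 1]) `&`
     [set z : R * 'rV[R]_m | \sum_i z.2 0 i * 1 = 1] `&`
     (\bigcap_(i in [set: 'I_m])
        [set z : R * 'rV[R]_m | 0 <= (z.2 *m B *m A) 0 i - z.1 * (z.2 *m B) 0 i]).
    apply/seteqP; split=> [[l x] [/= /andP[l0 lL] [x0 x1] H]|[l x] [[[[[/= l0 lL] x0] x1] sx] H]].
      split; first split; first split; first split; first split => //.
      - by move=> i _ /=; case/andP: (x0 i).
      - by move=> i _ /=; case/andP: (x0 i).
      - by rewrite /=; under eq_bigr do rewrite mulr1.
      - by move=> i _ /=; rewrite subr_ge0.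
    split=> /=; first by rewrite l0.
    - split=> [i|]; first by rewrite (x0 i) //= (x1 i).
      by move: sx; under eq_bigr do rewrite mulr1.
    - by move=> i; have := H i Logic.I; rewrite /= subr_ge0.
  have lf (c : 'I_m -> R) : continuous (fun z : R * 'rV[R]_m => \sum_k z.2 0 k * c k).
    move=> z; apply: (@continuous_comp _ _ _ snd (fun x : 'rV[R]_m => \sum_k x 0 k * c k)).
      exact: cvg_snd.
    exact: linear_form_continuous.
  have cmul (D : 'M[R]_m) i : continuous (fun z : R * 'rV[R]_m => (z.2 *m D) 0 i).
    rewrite (_ : (fun _ => _) = (fun z : R * 'rV[R]_m => \sum_k z.2 0 k * D k i)) //.
    by apply/funext => z; rewrite mxE.
  have ccoord i : continuous (fun z : R * 'rV[R]_m => z.2 0 i).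
    move=> z; apply: (@continuous_comp _ _ _ snd (fun x : 'rV[R]_m => x 0 i)).
      exact: cvg_snd.
    exact: coord_continuous.
  have cfst : continuous (@fst R 'rV[R]_m) by move=> z; exact: cvg_fst.
  have cl (f : R * 'rV[R]_m -> R) D : continuous f -> closed D -> closed [set z | D (f z)].
    by move=> cf; exact: (continuous_closedP f).1 cf _.
  repeat apply: closedI.
  - exact: (cl fst _ cfst (@closed_ge R 0)).
  - exact: (cl fst _ cfst (@closed_le R L)).
  - by apply: closed_bigI => i _; exact: (cl _ _ (ccoord i) (@closed_ge R 0)).
  - by apply: closed_bigI => i _; exact: (cl _ _ (ccoord i) (@closed_le R 1)).
  - exact: (cl _ _ (lf (fun=> 1)) (@closed_eq R 1)).
  - apply: closed_bigI => i _.
    apply: (cl (fun z => (z.2 *m B *m A) 0 i - z.1 * (z.2 *m B) 0 i) _ _ (@closed_ge R 0)).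
    have c1 : continuous (fun z : R * 'rV[R]_m => (z.2 *m B *m A) 0 i).
      have -> : (fun z : R * 'rV[R]_m => (z.2 *m B *m A) 0 i) =
                (fun z => (z.2 *m (B *m A)) 0 i).
        by apply/funext => z; rewrite mulmxA.
      exact: cmul.
    move=> z; apply: cvgB; first exact: (c1 z).
    by apply: cvgM; [exact: cfst|exact: (cmul B i z)].
have L0 : 0 <= L by apply: sumr_ge0 => i _; apply: sumr_ge0.
have normalize u (l : R) : 0 <= l -> (forall i, 0 < u 0 i) ->
    (forall i, l * (u *m B) 0 i <= (u *m B *m A) 0 i) -> exists x, K (l, x).
  move=> l0 u0 H; set s := \sum_i u 0 i.
  have s0 : 0 < s.
    rewrite /s (bigD1 (Ordinal m0)) //= ltr_pwDl // sumr_ge0 // => i _; exact: ltW.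
  exists (s^-1 *: u).
  have sx : simplex (s^-1 *: u).
    split=> [i|]; last by under eq_bigr do rewrite mxE; rewrite -mulr_sumr mulVf ?gt_eqF.
    rewrite mxE; apply/andP; split.
      by apply: mulr_ge0; apply: ltW; rewrite ?invr_gt0.
    rewrite mulrC ler_pdivrMr // mul1r.
    by rewrite /s (bigD1 i) //= lerDl sumr_ge0 // => j _; exact: ltW.
  have H' i : l * (s^-1 *: u *m B) 0 i <= (s^-1 *: u *m B *m A) 0 i.
    rewrite -!scalemxAl [leLHS](_ : _ = s^-1 * (l * (u *m B) 0 i)); last first.
      by rewrite mxE mulrCA.
    by rewrite [leRHS]mxE ler_wpM2l // invr_ge0 ltW.
  by split=> //=; rewrite l0 (bound _ _ sx).
have K0 : K !=set0.
  have [||x Kx] := normalize (const_mx 1) 0 (lexx 0).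
  - by move=> i; rewrite mxE.
  - move=> i; rewrite mul0r -mulmxA mulmx_ge0 // => a b; first by rewrite mxE.
    by apply: mulmx_ge0 => // c d; exact: ltW.
  by exists (0, x).
have [|[l x]] := compact_EVT_max (f := fst) K0 Kc.
  by apply: continuous_subspaceT => z; exact: cvg_fst.
rewrite inE => -[/= /andP[l0 lL] sx H] lmax.
have u0 := posB x (fun i => (andP (sx.1 i)).1) (simplex_pos x sx).
set u := x *m B in H u0.
exists l, u; split=> //; apply/eqP; rewrite -subr_eq0; apply: contraT => v0.
set v := u *m A - l *: u in v0.
have v_ge0 i : 0 <= v 0 i.
  by rewrite /v row_subZ subr_ge0; exact: H.
have vB : forall i, 0 < (v *m B) 0 i.
  apply: posB => //; apply: contrapT => /forallNP h; move/negP: v0; apply.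
  apply/eqP/rowP => i; apply/eqP; rewrite [X in _ == X]mxE eq_le v_ge0 andbT leNgt.
  by apply/negP; exact: h.
have u'0 : forall i, 0 < (u *m B) 0 i.
  by apply: (posB u); [move=> i; exact/ltW/u0|exists (Ordinal m0); exact: u0].
have vBE : v *m B = u *m B *m A - l *: (u *m B).
  by rewrite /v mulmxBl -scalemxAl -!mulmxA AB.
(* The reciprocal of the sum is at most each quotient (v B)_i / (u B)_i, hence an admissible
   increase of l. *)
pose e := (\sum_i (u *m B) 0 i / (v *m B) 0 i)^-1.
have q0 i : 0 < (u *m B) 0 i / (v *m B) 0 i by rewrite divr_gt0.
have e0 : 0 < e.
  rewrite invr_gt0 (bigD1 (Ordinal m0)) //= ltr_pwDl // sumr_ge0 // => i _.
  exact: ltW.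
have [|//|i|x' Kx'] := normalize u (l + e); first by rewrite addr_ge0 // ltW.
  have : e * (u *m B) 0 i <= (v *m B) 0 i.
    rewrite /e mulrC ler_pdivrMr; last by rewrite -invr_gt0.
    rewrite mulrC -ler_pdivrMr // (bigD1 i) //= lerDl sumr_ge0 // => k _.
    exact: ltW.
  rewrite vBE row_subZ mulrDl; lra.
have := lmax (l + e, x'); rewrite inE => /(_ Kx') /=.
by rewrite gerDl leNgt e0.
Qed.

Lemma irreducible_trmx A : irreducible_mx A -> irreducible_mx A^T.
Proof.
move=> [A0 Ac]; split=> i j; first by rewrite mxE.
have /= E := connect_rev (fun i j => 0 < A i j) i j.
have := Ac j i; rewrite -E.
by apply: connect_sub => k l kl; apply: connect1; rewrite /= mxE.
Qed.

Lemma row_col_gt0 (x : 'rV[R]_m) (y : 'cV[R]_m) : (0 < m)%N ->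
  (forall i, 0 < x 0 i) -> (forall i, 0 < y i 0) -> 0 < (x *m y) 0 0.
Proof.
move=> m0 x0 y0; apply: (mulmx_gt0 (k := Ordinal m0)) => // i j.
  by rewrite (ord1 i) ltW.
by rewrite (ord1 j) ltW.
Qed.

(** The eigenvalues of the left and the right vector agree, since x A y is both l (x y) and l' (x
    y), and x y > 0. *)
Lemma perron_pair A : (0 < m)%N -> irreducible_mx A ->
  exists (l : R) (x : 'rV[R]_m) (y : 'cV[R]_m), [/\ 0 <= l,
    (forall i, 0 < x 0 i) /\ (forall i, 0 < y i 0),
    x *m A = l *: x & A *m y = l *: y].
Proof.
move=> m0 Airr; have [l [x [l0 x0 xA]]] := perron_left m0 Airr.
have [l' [y [l'0 y0 yA]]] := perron_left m0 (irreducible_trmx Airr).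
have yt i : 0 < y^T i 0 by rewrite mxE.
have Ay : A *m y^T = l' *: y^T by rewrite -[A]trmxK -trmx_mul yA linearZ.
suff E : l = l' by exists l, x, y^T; split=> //; rewrite E.
have := row_col_gt0 m0 x0 yt; set d := (_ *m _) 0 0 => d0.
have : (x *m A *m y^T) 0 0 = l * d by rewrite xA -scalemxAl mxE.
rewrite -mulmxA Ay -scalemxAr mxE -/d => /esym.
by apply: mulIf; rewrite gt_eqF.
Qed.

(** For a complex left eigenvector v with eigenvalue a, the vector of moduli satisfies |a| |v| <=
    |v| A. Pairing with the positive right vector y gives |a| <= l. *)
Lemma perron_spectral_radius A : (0 < m)%N -> irreducible_mx A ->
  exists (x : 'rV[R]_m) (y : 'cV[R]_m), [/\ 0 <= spectral_radius A,
    (forall i, 0 < x 0 i) /\ (forall i, 0 < y i 0),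
    x *m A = spectral_radius A *: x & A *m y = spectral_radius A *: y].
Proof.
move=> m0 Airr; have [A0 _] := Airr.
have [l [x [y [l0 [x0 y0] xA Ay]]]] := perron_pair m0 Airr.
suff -> : spectral_radius A = l by exists x, y.
rewrite /spectral_radius; set S := (X in sup X).
have Sl : S l.
  exists l%:C%C; last by rewrite normc_real ger0_norm.
  apply/eigenvalueP; exists (map_mx (real_complex R) x).
    by rewrite -map_mxM xA map_mxZ.
  apply/eqP => /rowP/(_ (Ordinal m0)); rewrite !mxE => -[] E.
  by have := x0 (Ordinal m0); rewrite E ltxx.
have Sub r : S r -> r <= l.
  move=> [a /eigenvalueP[v vA v0] ->].
  pose w : 'rV[R]_m := \row_i normc (v 0 i).
  have wA i : normc a * w 0 i <= (w *m A) 0 i.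
    rewrite !mxE -normcM.
    have -> : a * v 0 i = \sum_k v 0 k * (A k i)%:C%C.
      have := congr1 (fun u : 'rV[R[i]]_m => u 0 i) vA; rewrite !mxE => <-.
      by apply: eq_bigr => k _; rewrite mxE.
    apply: (@le_trans _ _ (\sum_k normc (v 0 k * (A k i)%:C%C))).
      elim/big_ind2: _ => [|p q p' q' pq p'q'|//]; first by rewrite normc0.
      exact: (le_trans (le_normcD _ _) (lerD pq p'q')).
    apply: ler_sum => k _; rewrite normcM normc_real ger0_norm // mxE //.
  have d0 : 0 < (w *m y) 0 0.
    have [k vk] : exists k, v 0 k != 0.
      apply/existsP; rewrite -negb_forall; apply: contra v0 => /forallP H.
      by apply/eqP/rowP => k; rewrite mxE; apply/eqP.
    apply: (mulmx_gt0 (k := k)) => //.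
    - by move=> i j; rewrite mxE normc_ge0.
    - by move=> i j; rewrite (ord1 j) ltW.
    - by rewrite mxE normc_gt0.
  rewrite -(ler_pM2r d0).
  have <- : (w *m A *m y) 0 0 = l * (w *m y) 0 0 by rewrite -mulmxA Ay -scalemxAr mxE.
  rewrite mxE [leRHS]mxE mulr_sumr ler_sum // => k _; rewrite mulrA.
  by rewrite ler_wpM2r // ltW.
apply/eqP; rewrite eq_le; apply/andP; split.
  by apply: ge_sup => //; exists l.
by apply: ub_le_sup => //; exists l.
Qed.

(** Compares x A y with c x B y, for x the left Perron vector of A and y the right Perron vector of
    B. *)
Lemma spectral_radius_le A B (c : R) : (0 < m)%N ->
  irreducible_mx A -> irreducible_mx B -> (forall i j, A i j <= c * B i j) ->
  spectral_radius A <= c * spectral_radius B.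
Proof.
move=> m0 Airr Birr AB.
have [x [_ [_ [x0 _] xA _]]] := perron_spectral_radius m0 Airr.
have [_ [y [_ [_ y0] _ By]]] := perron_spectral_radius m0 Birr.
have d0 := row_col_gt0 m0 x0 y0; rewrite -(ler_pM2r d0).
have -> : spectral_radius A * (x *m y) 0 0 = (x *m A *m y) 0 0.
  by rewrite xA -scalemxAl [RHS]mxE.
have -> : c * spectral_radius B * (x *m y) 0 0 = (x *m (c *: B) *m y) 0 0.
  by rewrite -mulmxA -scalemxAl By -!scalemxAr scalerA [RHS]mxE.
rewrite mxE [leRHS]mxE; apply: ler_sum => j _; apply: ler_wpM2r; first exact: ltW.
rewrite mxE [leRHS]mxE; apply: ler_sum => i _; apply: ler_wpM2l; first exact: ltW.
by rewrite mxE.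
Qed.

End Perron.

(** * Fibres and iterates of the system *)

Section SystemBasics.
Variables (R : realType) (m : nat) (F : partitioned_system R m).
Local Notation C := (R[i]^o).
Local Notation T := (sysmap F).
Local Notation PC := (postcritical F).
Implicit Types (z w : sphere R) (i j : 'I_m) (k : nat).

(** With multiplicity at least 2, G z - G a would be of order h^2 at distance h from a, while a
    nonzero derivative l keeps it above |l| h / 2. *)
Lemma local_degree_simple (f : sphere R -> sphere R) w k (s : R) :
  sdiff f w s -> s != 0 -> local_degree f w k -> k = 1%N.
Proof.
move=> [_ [l dl sE]] s0 [k0 [g [cg g0 Fg]]].
have l0 : 0 < normc l.
  rewrite normc_gt0; apply: contra s0 => /eqP l0.
  by rewrite sE l0 normc0 !mul0r.
apply/eqP; rewrite eqn_leq k0 andbT leqNgt; apply/negP => k1.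
set a := chart w w in dl Fg cg g0; set G := chart_rep f w in dl Fg.
have [d1 d10 H1] := dl (normc l / 2) (divr_gt0 l0 (ltr0n R 2)).
have [d2 d20 H2] := (nbhs_normcP _ _).1 Fg.
have gn : \forall z \near a, normc (g z - g a) < 1.
  have N1 : nbhs (g a) [set y | normc (y - g a) < 1] by apply/nbhs_normcP; exists 1.
  exact: (cg _ N1).
have [d3 d30 H3] := (nbhs_normcP _ _).1 gn.
pose M := normc (g a) + 1; have M0 : 0 < M by rewrite ltr_wpDl ?normc_ge0.
pose d := Num.min (Num.min 1 (normc l / (4 * M))) (Num.min d1 (Num.min d2 d3)).
have d0 : 0 < d by rewrite !lt_min ltr01 d10 d20 d30 divr_gt0 // mulr_gt0.
pose h := d / 2; have h0 : 0 < h by rewrite divr_gt0.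
have : h < d by rewrite ltr_pdivrMr // ltr_pMr // ltr1n.
rewrite !lt_min => /andP[/andP[h1 hM] /andP[hd1 /andP[hd2 hd3]]].
pose z : C := a + h%:C%C.
have za : normc (z - a) = h by rewrite /z addrC addKr normc_real gtr0_norm.
have A1 := H1 z; rewrite za in A1; have {}A1 := A1 hd1.
have A2 := H2 z; rewrite za in A2; have {}A2 := A2 hd2.
have A3 := H3 z; rewrite za in A3; have {}A3 := A3 hd3.
have gz : normc (g z) <= M.
  by rewrite /M; have := normc_le_distD (g z) (g a); lra.
have up : normc (G z - G a) <= h * h * M.
  have h0' := ltW h0; have h1' := ltW h1.
  rewrite A2 normcM normcX za; apply: ler_pM => //; rewrite ?normc_ge0 ?exprn_ge0 //.
  by rewrite -expr2 -(subnKC k1) exprD ler_piMr ?exprn_ge0 // exprn_ile1.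
have low : normc l * h <= normc (G z - G a) + normc l / 2 * h.
  have := normc_le_distD (l * (z - a)) (G z - G a).
  by rewrite normcM za [normc (l * _ - _)]normc_distC; lra.
rewrite ltr_pdivlMr ?mulr_gt0 // in hM.
have : h * (h * (4 * M)) < h * normc l by rewrite ltr_pM2l.
have : 0 < h * normc l by rewrite mulr_gt0.
lra.
Qed.

Lemma tile_inj i j z : tile F i z -> tile F j z -> i = j.
Proof.
move=> zi zj; apply/eqP; apply: contraT => ij.
have : (tile F i `&` tile F j) z by split.
by rewrite (@tile_disjoint _ _ F _ _ ij).
Qed.

Lemma sysmapE i z : tile F i z -> T z = branch F i z.
Proof.
move=> zi; rewrite /sysmap; case: pickP => [j /asboolP zj|/(_ i)].
  by rewrite (tile_inj zi zj).
by move/asboolP.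
Qed.

Lemma tile_near i z : tile F i z -> \forall q \near z, tile F i q.
Proof. by move=> zi; apply: open_nbhs_nbhs; split=> //; exact: tile_open. Qed.

Lemma sysmap_near i z : tile F i z -> \forall q \near z, branch F i q = T q.
Proof. by move=> /tile_near; apply: filterS => q /sysmapE. Qed.

Lemma branch_sdiff i z : tile F i z -> sdiff (branch F i) z (sderiv (branch F i) z).
Proof.
move=> zi; have [hol _ _] := branch_covering F i.
by have [cf df] := hol z zi; exact: holomorphic_sdiff.
Qed.

Lemma sysmap_branch_sdiff i z : tile F i z -> sdiff T z (sderiv (branch F i) z).
Proof.
by move=> zi; apply: sdiff_near (sysmap_near zi) _; exact: branch_sdiff.
Qed.

Lemma sderiv_sysmap i z : tile F i z -> sderiv T z = sderiv (branch F i) z.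
Proof. by move=> /sysmap_branch_sdiff /sdiff_sderiv. Qed.

Lemma sysmap_sdiff z : tiles F z -> sdiff T z (sderiv T z).
Proof. by move=> [i _ zi]; rewrite (sderiv_sysmap zi); exact: sysmap_branch_sdiff. Qed.

Lemma sysmap_continuous z : tiles F z -> {for z, continuous T}.
Proof. by move=> /sysmap_sdiff []. Qed.

Lemma tiles_open : open (tiles F).
Proof. by apply: bigcup_open => i _; exact: tile_open. Qed.

Lemma tiles_near z : tiles F z -> \forall q \near z, tiles F q.
Proof. by move=> tz; apply: open_nbhs_nbhs; split=> //; exact: tiles_open. Qed.

Lemma postcritical_near z : ~ PC z -> \forall q \near z, ~ PC q.
Proof.
move=> pz; apply: open_nbhs_nbhs; split=> //.
by apply: (@closed_openC _ PC); exact: closed_closure.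
Qed.

Lemma noncritical w : tiles F w -> ~ PC (T w) -> sderiv T w != 0.
Proof.
move=> tw nP; apply/eqP => s0; apply: nP; apply: subset_closure.
exists (T w); last by exists 0%N => // l.
by split; [case: tw => i _ wi; exists i => //; exists w => //; rewrite -sysmapE|exists w].
Qed.

(** Used in the contrapositive: preimages of points outside the postcritical set are again outside,
    so unramified fibres persist under iteration. Continuity of the map on the open tiles carries
    invariance over to the closure. *)
Lemma postcritical_forward w : tiles F w -> PC w -> PC (T w).
Proof.
move=> tw Pw N hN; have TN : nbhs w (T @^-1` N) := sysmap_continuous tw hN.
have [q [[c cc [k kd <-]] [TNq tq]]] := Pw _ (filterI TN (tiles_near tw)).
exists (iter k.+1 T c); split=> //; exists c => //; exists k.+1 => // l.
by rewrite ltnS leq_eqVlt => /orP[/eqP->//|]; exact: kd.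
Qed.

Lemma iter_definedS k w :
  iter_defined F k.+1 w <-> iter_defined F k w /\ tiles F (iter k T w).
Proof.
split=> [H|[H Hk] l]; first by split=> [l lk|]; apply: H => //; exact: ltnW.
by rewrite ltnS leq_eqVlt => /orP[/eqP->//|]; exact: H.
Qed.

Lemma degreeP i : has_degree (tile F i) (branch F i) (degree (tile F i) (branch F i)).
Proof. by have [_ _ [d dP]] := branch_covering F i; exact: (xgetPex 0%N (ex_intro _ d dP)). Qed.

(** Off the postcritical set all multiplicities are 1, so the degree counts points. *)
Lemma fibre i z : (branch F i @` tile F i) z -> ~ PC z ->
  exists s : seq (sphere R), [/\ uniq s,
    [set` s] = tile F i `&` branch F i @^-1` [set z] &
    size s = degree (tile F i) (branch F i)].
Proof.
move=> zi nP; have [s [mult [us sE md <-]]] := degreeP zi.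
exists s; split=> //; rewrite -sum1_size big_seq [RHS]big_seq.
apply: eq_bigr => w ws; have : [set` s] w by [].
rewrite sE => -[wi wz].
rewrite (local_degree_simple (branch_sdiff wi) _ (md w ws)) //.
rewrite -(sderiv_sysmap wi) noncritical //; first by exists i.
by rewrite (sysmapE wi) wz.
Qed.

Lemma sysmap_open w : tiles F w -> ~ PC (T w) ->
  forall N, nbhs w N -> nbhs (T w) (T @` N).
Proof.
move=> tw nP; apply: sdiff_noncritical_open.
have := sysmap_continuous tw (postcritical_near nP); rewrite nbhs_simpl /=.
apply: filterS2 (tiles_near tw) => q tq nPq.
by exists (sderiv T q); [exact: noncritical|exact: sysmap_sdiff].
Qed.

(** Local injectivity is deduced from the constant fibre size of the branch at w; near w the system
    agrees with that branch. *)
Lemma sysmap_local_homeo w : tiles F w -> ~ PC (T w) -> local_homeo T w.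
Proof.
move=> tw nP; have [i _ wi] := tw.
have fT : \forall q \near w, T q = branch F i q.
  by apply: filterS (sysmap_near wi) => q ->.
split; [exact: sysmap_continuous|exact: sysmap_open|].
have branch_open x N : tile F i x -> branch F i x = branch F i w -> nbhs x N ->
    nbhs (branch F i w) (branch F i @` N).
  move=> xi xw xN; rewrite -xw -(sysmapE xi).
  have : nbhs (T x) (T @` (N `&` tile F i)).
    apply: sysmap_open; first by exists i.
      by rewrite (sysmapE xi) xw -(sysmapE wi).
    by apply: filterI => //; exact: tile_near.
  by apply: filterS => _ [q [Nq qi] <-]; exists q => //; rewrite (sysmapE qi).
have [N wN NI] := constant_fibre_local_inj (f := branch F i) (U := tile F i)
  (W := [set z | ~ PC z] `&` branch F i @` tile F i)
  (n := degree (tile F i) (branch F i)) (w := w)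
  (@tile_open _ _ F i) wi (branch_sdiff wi).1
  (filterI (postcritical_near (eq_ind _ (fun z => ~ PC z) nP _ (sysmapE wi)))
     (branch_open w _ wi (erefl _) (tile_near wi)))
  (fun z Wz => fibre Wz.2 Wz.1) branch_open.
exists (N `&` [set q | T q = branch F i q]); first exact: filterI.
by move=> q q' [Nq /= ->] [Nq' /= ->]; exact: NI.
Qed.

Lemma iter_local_homeo k w : iter_defined F k w -> ~ PC (iter k T w) ->
  local_homeo (iter k T) w.
Proof.
elim: k => [|k IH]; first by move=> _ _; exact: local_homeo_id.
move=> /iter_definedS[dk tk] nP.
apply: (local_homeo_comp (f := iter k T) (g := T)).
  by apply: IH => // P; apply: nP; exact: postcritical_forward.
exact: sysmap_local_homeo.
Qed.

Lemma iter_sdiff k w : iter_defined F k w ->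
  sdiff (iter k T) w (\prod_(l < k) sderiv T (iter l T w)).
Proof.
elim: k => [|k IH]; first by rewrite big_ord0 => _; exact: sdiff_id.
move=> /iter_definedS[/IH dk tk]; rewrite big_ord_recr /= mulrC.
by apply: (sdiff_comp (f := iter k T) (g := T)) => //; exact: sysmap_sdiff.
Qed.

Lemma iter_continuous k w : iter_defined F k w -> {for w, continuous (iter k T)}.
Proof. by move=> /iter_sdiff []. Qed.

(** Properness concerns compact subsets of the image of a branch, and that image need not be closed.
    By the Markov property its part in K is K minus the open tiles that miss the image, hence
    compact. *)
Lemma preimage_compact K : compact K -> K `<=` tiles F ->
  compact [set w | tiles F w /\ K (T w)].
Proof.
move=> cK Kt.
have -> : [set w | tiles F w /\ K (T w)] = \big[setU/set0]_(i < m)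
    (tile F i `&` branch F i @^-1` (K `&` branch F i @` tile F i)).
  apply/seteqP; split=> w.
    move=> [[i _ wi] Kw]; rewrite -bigcup_seq; exists i; first exact: mem_index_enum.
    by split=> //=; rewrite -(sysmapE wi); split=> //; exists w => //; rewrite (sysmapE wi).
  rewrite -bigcup_seq => -[i _ [wi [Kw _]]]; split; first by exists i.
  by rewrite (sysmapE wi).
apply: bigsetU_compact => i _.
have [_ pr _] := branch_covering F i; apply: pr; first by move=> z [].
have -> : K `&` branch F i @` tile F i =
    K `&` ~` (\bigcup_(j in [set j | (branch F i @` tile F i) `&` tile F j = set0]) tile F j).
  apply/seteqP; split=> z [Kz zi]; split=> //.
    move=> [j /= E zj]; have : ((branch F i @` tile F i) `&` tile F j) z by split.
    by rewrite E.
  have [j _ zj] := Kt z Kz; have [|E] := @Defs.markov _ _ F i j; first by apply.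
  by exfalso; apply: zi; exists j.
apply: compact_closedI => //; apply: open_closedC.
by apply: bigcup_open => j _; exact: tile_open.
Qed.

Lemma iter_preimage_compact k K : compact K -> K `<=` tiles F ->
  compact [set w | iter_defined F k w /\ K (iter k T w)].
Proof.
elim: k K => [|k IH] K cK Kt.
  by have -> : [set w | iter_defined F 0 w /\ K (iter 0 T w)] = K
    by apply/seteqP; split=> w => [[]|Kw] //; split=> // l.
have -> : [set w | iter_defined F k.+1 w /\ K (iter k.+1 T w)] =
  [set w | iter_defined F k w /\ [set v | tiles F v /\ K (T v)] (iter k T w)].
  apply/seteqP; split=> w; first by move=> [/iter_definedS[dk tk] Kw].
  by move=> [dk [tk Kw]]; split=> //; apply/iter_definedS.
by apply: IH => [|v []//]; exact: preimage_compact.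
Qed.

End SystemBasics.

(** * Sums over fibres as column sums of McMullen's matrix *)

Section FibreSums.
Variables (R : realType) (m : nat) (F : partitioned_system R m).
Local Notation T := (sysmap F).
Local Notation PC := (postcritical F).
Local Notation deg i := (degree (tile F i) (branch F i)).
Hypothesis Hne : image_tiles F `\` PC !=set0.
Hypothesis Hsup : forall i j : 'I_m, has_ubound (transition_derivs F i j).
Implicit Types (z w : sphere R) (i j : 'I_m) (k : nat).

Definition transition i j : bool := `[< transition_set F i j !=set0 >].
Definition sup_deriv i j : R := sup (transition_derivs F i j).

Lemma transitionP i j w : tile F i w -> tile F j (branch F i w) -> transition i j.
Proof. by move=> wi wj; apply/asboolP; exists w. Qed.

Lemma transition_image i j : transition i j -> tile F j `<=` branch F i @` tile F i.
Proof.
move=> /asboolP[w [wi wj]]; have [//|E] := @Defs.markov _ _ F i j.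
have : ((branch F i @` tile F i) `&` tile F j) (branch F i w) by split=> //; exists w.
by rewrite E.
Qed.

(** Turns a composition provided by transitivity into a path of the transition graph, and pulls
    non-postcritical points back along it. *)
Lemma composable_connect l j w i : composable (tile F) (branch F) (j :: l) w ->
  tile F i (compose (branch F) (j :: l) w) -> connect transition j i /\
  (~ PC (compose (branch F) (j :: l) w) -> ~ PC w).
Proof.
elim: l j w => [|j' l IH] j w /= [wj H] wi.
  split; first by apply: connect1; exact: transitionP wj wi.
  by rewrite -(sysmapE wj) => nP P; apply: nP; apply: postcritical_forward => //; exists j.
have [h1 h2] := IH j' _ H wi.
split; first by apply: connect_trans h1; apply: connect1; exact: transitionP wj H.1.
move=> /h2; rewrite -(sysmapE wj) => nP P; apply: nP.
by apply: postcritical_forward => //; exists j.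
Qed.

Lemma noncritical_tile : exists j z, tile F j z /\ ~ PC z.
Proof.
have [z [[i _ [w wi <-]] nP]] := Hne; exists i, w; split=> //.
rewrite -(sysmapE wi) in nP => P; apply: nP.
by apply: postcritical_forward => //; exists i.
Qed.

(** Some tile contains a point z outside the postcritical set. By transitivity a composition
    starting in tile i takes the value z, and the point where it does so is not postcritical
    either. *)
Lemma noncritical_point i : exists2 z, tile F i z & ~ PC z.
Proof.
have [j [z [zj nP]]] := noncritical_tile.
have [l [W [oW Wi Wc WE]]] := @transitivity _ _ F i.
have [w Ww wz] : (compose (branch F) (i :: l) @` W) z by rewrite WE; exists j.
exists w; first exact: Wi.
have := @composable_connect l i w j (Wc w Ww); rewrite wz => /(_ zj)[_]; exact.
Qed.

Lemma transition_connect i j : connect transition i j.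
Proof.
have [z zj _] := noncritical_point j.
have [l [W [oW Wi Wc WE]]] := @transitivity _ _ F i.
have [w Ww wz] : (compose (branch F) (i :: l) @` W) z by rewrite WE; exists j.
by have := @composable_connect l i w j (Wc w Ww); rewrite wz => /(_ zj)[].
Qed.

Lemma transition_step w i j : tile F i w -> tile F j (T w) -> transition i j.
Proof. by move=> wi; rewrite (sysmapE wi); exact: transitionP. Qed.

Lemma sderiv_le_sup w i j : tile F i w -> tile F j (T w) ->
  sderiv T w <= sup_deriv i j.
Proof.
move=> wi wj; rewrite (sderiv_sysmap wi); apply: ub_le_sup; first exact: Hsup.
by exists w => //; split=> //=; rewrite -(sysmapE wi).
Qed.

Lemma transition_preimage i j : transition i j ->
  exists w, [/\ tile F i w, tile F j (T w) & ~ PC (T w)].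
Proof.
move=> ij; have [z zj nP] := noncritical_point j.
have [w wi wz] := transition_image ij zj; exists w.
by rewrite (sysmapE wi) wz.
Qed.

Lemma sup_deriv_gt0 i j : transition i j -> 0 < sup_deriv i j.
Proof.
move=> /transition_preimage[w [wi wj nP]].
have tw : tiles F w by exists i.
apply: lt_le_trans (sderiv_le_sup wi wj).
by rewrite lt_def noncritical //= (sdiff_ge0 (sysmap_sdiff tw)).
Qed.

Lemma degree_gt0 i j : transition i j -> (0 < deg i)%N.
Proof.
move=> /transition_preimage[w [wi wj nP]].
have [|s [us sE <-]] := @fibre _ _ F i (T w) _ nP.
  by exists w => //; rewrite (sysmapE wi).
have : [set` s] w by rewrite sE; split=> //=; rewrite (sysmapE wi).
by case: (s).
Qed.

Lemma mcmullenE t i j : mcmullen_matrix F t i j =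
  if transition i j then (deg i)%:R * sup_deriv i j `^ (- t) else 0.
Proof. by rewrite mxE. Qed.

Lemma mcmullen_irreducible t : irreducible_mx (mcmullen_matrix F t).
Proof.
split=> i j.
  by rewrite mcmullenE; case: ifP => // _; rewrite mulr_ge0 // powR_ge0.
apply: connect_sub (transition_connect i j) => k l kl; apply: connect1.
rewrite /= mcmullenE kl mulr_gt0 ?powR_gt0 ?sup_deriv_gt0 //.
by rewrite ltr0n (degree_gt0 kl).
Qed.

Variable i0 : 'I_m.

(** The value [i0] outside the tiles is a dummy. *)
Definition tile_index z : 'I_m := odflt i0 [pick i | `[< tile F i z >]].

Lemma tile_indexE i z : tile F i z -> tile_index z = i.
Proof.
move=> zi; rewrite /tile_index; case: pickP => [j /asboolP zj|/(_ i)].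
  exact: tile_inj zj zi.
by move/asboolP.
Qed.

(** The product S(w). Its last factor involves the tile of the k-th iterate, so that iterate has to
    lie in a tile. *)
Definition itinerary_bound k w : R :=
  \prod_(l < k) sup_deriv (tile_index (iter l T w)) (tile_index (iter l.+1 T w)).

Lemma itinerary_boundS k w : itinerary_bound k.+1 w = itinerary_bound k w *
  sup_deriv (tile_index (iter k T w)) (tile_index (iter k.+1 T w)).
Proof. by rewrite /itinerary_bound big_ord_recr. Qed.

Lemma itinerary_bound_gt0 k w : iter_defined F k w -> tiles F (iter k T w) ->
  0 < itinerary_bound k w.
Proof.
elim: k => [|k IH]; first by rewrite /itinerary_bound big_ord0.
move=> /iter_definedS[dk [i _ ik]] [j _ jk]; rewrite itinerary_boundS mulr_gt0 //.
  by apply: IH => //; exists i.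
rewrite (tile_indexE ik) (tile_indexE jk); apply: sup_deriv_gt0.
exact: transition_step ik jk.
Qed.

Lemma iter_deriv_le k w : iter_defined F k w -> tiles F (iter k T w) ->
  sderiv (iter k T) w <= itinerary_bound k w.
Proof.
move=> dk tk; rewrite (sdiff_sderiv (iter_sdiff dk)).
elim: k dk tk => [|k IH]; first by rewrite /itinerary_bound !big_ord0.
move=> /iter_definedS[dk [i _ ik]] [j _ jk].
rewrite itinerary_boundS big_ord_recr /=; apply: ler_pM.
- apply: prodr_ge0 => l _; apply: (@sdiff_ge0 _ T (iter l T w)).
  by apply: sysmap_sdiff; apply: dk.
- by apply: (@sdiff_ge0 _ T (iter k T w)); apply: sysmap_sdiff; exists i.
- by apply: IH => //; exists i.
- by rewrite (tile_indexE ik) (tile_indexE jk) sderiv_le_sup.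
Qed.

Lemma iter_deriv_gt0 k w : iter_defined F k w -> ~ PC (iter k T w) ->
  0 < sderiv (iter k T) w.
Proof.
move=> dk nP; rewrite (sdiff_sderiv (iter_sdiff dk)).
elim: k dk nP => [|k IH]; first by rewrite big_ord0.
move=> /iter_definedS[dk tk] nP; rewrite big_ord_recr /= mulr_gt0 //.
  by apply: IH => // P; apply: nP; exact: postcritical_forward.
by rewrite lt_def noncritical //= (sdiff_ge0 (sysmap_sdiff tk)).
Qed.

Definition col_sums t k : 'rV[R]_m :=
  iter k (mulmx^~ (mcmullen_matrix F t)) (const_mx 1).

Lemma direct_preimages z j : tile F j z -> ~ PC z ->
  exists s : 'I_m -> seq (sphere R), forall i, [/\ uniq (s i),
    forall w, w \in s i <-> tile F i w /\ T w = z &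
    size (s i) = if transition i j then deg i else 0%N].
Proof.
move=> zj nP.
have H i : exists s : seq (sphere R), [/\ uniq s,
    forall w, w \in s <-> tile F i w /\ T w = z &
    size s = if transition i j then deg i else 0%N].
  case: ifPn => [ij|nij]; last first.
    exists [::]; split=> // w; split=> // -[wi wz]; move/negP: nij; case.
    by apply: (transition_step wi); rewrite wz.
  have [s [us sE sn]] := fibre (transition_image ij zj) nP.
  exists s; split=> // w.
  have -> : (w \in s : Prop) = [set` s] w by [].
  by rewrite sE; split=> -[wi wz]; split=> //; rewrite -wz (sysmapE wi).
by have [s Hs] := boolp.choice H; exists s.
Qed.

(** Induction on the last step before z. Each tile i with a transition to j contains [deg i] direct
    preimages of z; each contributes the i-th column sum times the same power of the supremum, which
    is right multiplication by the matrix. One list serves for all t. *)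
Lemma iter_preimages k z j : tile F j z -> ~ PC z ->
  exists s : seq (sphere R), [/\ uniq s,
    forall w, w \in s <-> iter_defined F k w /\ iter k T w = z &
    forall t, \sum_(w <- s) itinerary_bound k w `^ (- t) = col_sums t k 0 j].
Proof.
elim: k z j => [|k IH] z j zj nP.
  exists [:: z]; split=> // [w|t].
    by rewrite inE; split=> [/eqP->|[_ /= ->]] //; split=> // l.
  by rewrite big_seq1 /itinerary_bound big_ord0 powR1 mxE.
have [s0 Hs0] := direct_preimages zj nP.
pose P := [seq u | i <- index_enum 'I_m, u <- s0 i].
have memP u : u \in P <-> tiles F u /\ T u = z.
  split=> [/allpairsPdep[i [u' [_ h ->]]]|[[i _ ui] uz]].
    by have [_ /(_ u')[+ _] _] := Hs0 i => /(_ h)[ui ->]; split=> //; exists i.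
  apply/allpairsPdep; exists i, u; split=> //; first exact: mem_index_enum.
  by have [_ /(_ u)[_ +] _] := Hs0 i; apply.
have uP : uniq P.
  apply: allpairs_uniq_dep; first exact: index_enum_uniq.
    by move=> i _; have [] := Hs0 i.
  move=> _ _ /allpairsPdep[i [u [_ ui ->]]] /allpairsPdep[i' [u' [_ u'i ->]]] /= E.
  rewrite -E in u'i *.
  have [_ /(_ u)[/(_ ui)[h _] _] _] := Hs0 i.
  have [_ /(_ u)[/(_ u'i)[h' _] _] _] := Hs0 i'.
  by rewrite (tile_inj h h').
have Hu u : exists s : seq (sphere R), u \in P -> [/\ uniq s,
    forall w, w \in s <-> iter_defined F k w /\ iter k T w = u &
    forall t, \sum_(w <- s) itinerary_bound k w `^ (- t) = col_sums t k 0 (tile_index u)].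
  have [/memP[[i _ ui] uz]|nu] := boolP (u \in P); last by exists [::].
  have nPu : ~ PC u.
    move=> Pu; apply: nP; rewrite -uz; apply: postcritical_forward => //.
    by exists i.
  by have [s Hs] := IH u i ui nPu; exists s => _; rewrite (tile_indexE ui).
have [h Hh] := boolp.choice Hu.
exists [seq w | u <- P, w <- h u]; split.
- apply: allpairs_uniq_dep => //; first by move=> u /Hh[].
  move=> _ _ /allpairsPdep[u [w [uP' wu ->]]] /allpairsPdep[u' [w' [u'P wu' ->]]] /= E.
  rewrite -E in wu' *.
  have [_ /(_ w)[/(_ wu)[_ <-] _] _] := Hh u uP'.
  by have [_ /(_ w)[/(_ wu')[_ <-] _] _] := Hh u' u'P.
- move=> w; rewrite iter_definedS; split=> [/allpairsPdep[u [w' [uP' wu ->]]]|[[dk tk] kz]].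
    have [_ /(_ w')[/(_ wu)[dk ku] _] _] := Hh u uP'.
    by have [tu uz] := (memP u).1 uP'; rewrite /= ku.
  have uP' : iter k T w \in P by apply/memP.
  apply/allpairsPdep; exists (iter k T w), w; split=> //.
  by have [_ /(_ w)[_ +] _] := Hh _ uP'; apply.
- move=> t; rewrite big_allpairs_dep /=.
  transitivity (\sum_(u <- P) col_sums t k 0 (tile_index u) *
      sup_deriv (tile_index u) j `^ (- t)).
    rewrite big_seq [RHS]big_seq; apply: eq_bigr => u uP'.
    have [_ hm <-] := Hh u uP'; rewrite big_distrl /= big_seq [RHS]big_seq.
    apply: eq_bigr => w /hm[dk ku]; have [tu uz] := (memP u).1 uP'.
    rewrite itinerary_boundS /= ku uz (tile_indexE zj) powRM //.
      by apply/ltW/itinerary_bound_gt0 => //; rewrite ku.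
    have [i _ ui] := tu; rewrite (tile_indexE ui); apply/ltW/sup_deriv_gt0.
    by apply: (transition_step ui); rewrite uz.
  rewrite big_allpairs_dep /= [RHS]mxE; apply: eq_bigr => i _.
  have [us hm sn] := Hs0 i.
  rewrite big_seq (eq_bigr (fun=> col_sums t k 0 i * sup_deriv i j `^ (- t))); last first.
    by move=> u /hm[ui _]; rewrite (tile_indexE ui).
  rewrite -big_seq big_const_seq count_predT iter_addr_0 sn mcmullenE.
  case: ifP => _; last by rewrite mulr0n mulr0.
  by rewrite -mulr_natr; ring.
Qed.

Lemma Theta_ge k z j t : 0 <= t -> tile F j z -> ~ PC z ->
  ((col_sums t k 0 j)%:E <= Theta F k z t)%E.
Proof.
move=> t0 zj nP; have [s [us sP <-]] := iter_preimages k zj nP.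
have tz : tiles F z by exists j.
rewrite /Theta.
set A := [set w | _]; have sA : [set` s] = A.
  apply/seteqP; split=> w; rewrite /A /=.
    (* For k = 0 being defined says nothing; w lies in a tile because it is z. *)
    move=> /sP[dk kz]; split=> //; case: (k) dk kz => [|k'] dk kz; last exact: (dk 0%N).
    by rewrite -[w]/(iter 0 T w) kz.
  by move=> [_ dk kz]; apply/sP.
rewrite -sA esum_fset; last 2 first.
- exact: finite_seq.
- by move=> w _; rewrite lee_fin powR_ge0.
rewrite -fsbig_seq // sumEFin lee_fin big_seq [leRHS]big_seq.
apply: ler_sum => w /sP[dk kz].
(* Powers of exponent -t reverse the order only between positive numbers. *)
have d0 : 0 < sderiv (iter k T) w by apply: iter_deriv_gt0; rewrite ?kz.
have dle : sderiv (iter k T) w <= itinerary_bound k w.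
  by apply: iter_deriv_le; rewrite ?kz.
rewrite !powRN lef_pV2 ?posrE ?powR_gt0 //; last exact: lt_le_trans dle.
by apply: ge0_ler_powR => //; rewrite nnegrE ltW // (lt_le_trans d0).
Qed.

End FibreSums.

(** * Separation of iterated preimages *)

Section Separation.
Variables (R : realType) (m : nat) (F : partitioned_system R m).
Local Notation C := (R[i]^o).
Local Notation T := (sysmap F).
Local Notation PC := (postcritical F).
Hypothesis Hne : image_tiles F `\` PC !=set0.
Hypothesis Hsup : forall i j : 'I_m, has_ubound (transition_derivs F i j).
Variables (i0 j0 : 'I_m) (c : C) (rho : R).
Hypothesis rho_gt0 : 0 < rho.
Hypothesis disc_tile : forall z, normc (z - c) <= rho ->
  tile F j0 (Some z) /\ ~ PC (Some z).
Implicit Types (w q b : sphere R) (k : nat).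
Local Notation index := (tile_index F i0).
Local Notation bound := (itinerary_bound F i0).

Definition base_disc : set (sphere R) := Some @` cdisc c rho.
Definition disc_preimage k : set (sphere R) :=
  [set w | iter_defined F k w /\ base_disc (iter k T w)].
Definition base_coord k w : C := chart (Some c : sphere R) (iter k T w).

Lemma base_disc_tiles : base_disc `<=` tiles F.
Proof. by move=> _ [z zc <-]; exists j0 => //; exact: (disc_tile zc).1. Qed.

Lemma base_discP q : base_disc q -> ~ PC q /\ chart_dom (Some c : sphere R) q.
Proof. by move=> [z zc <-]; split; [exact: (disc_tile zc).2|]. Qed.

Lemma disc_preimage_compact k : compact (disc_preimage k).
Proof.
apply: iter_preimage_compact; last exact: base_disc_tiles.
apply: continuous_compact; last exact: cdisc_compact.
by apply: continuous_subspaceT; exact: one_point_compactification_some_continuous.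
Qed.

Lemma disc_preimage_tiles k w : disc_preimage k w -> tiles F w.
Proof.
case: k => [|k] [dk wk]; first exact: base_disc_tiles wk.
exact: (dk 0%N).
Qed.

Lemma base_coordP k w : disc_preimage k w ->
  iter k T w = Some (base_coord k w) /\ normc (base_coord k w - c) <= rho.
Proof. by move=> [_ [z zc zE]]; rewrite /base_coord -zE. Qed.

Lemma iter_defined_near k w : iter_defined F k w ->
  \forall q \near w, iter_defined F k q.
Proof.
elim: k => [|k IH]; first by move=> _; apply: (@filterS _ (nbhs w) _ setT) filterT => q _ l.
move=> /iter_definedS[dk tk].
have h : \forall q \near w, tiles F (iter k T q) := iter_continuous dk (tiles_near tk).
by apply: filterS2 (IH dk) h => q dq tq; apply/iter_definedS.
Qed.

Lemma tile_index_near w : tiles F w -> \forall q \near w, index q = index w.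
Proof.
move=> [i _ wi]; apply: filterS (tile_near wi) => q qi.
by rewrite (tile_indexE _ wi) (tile_indexE _ qi).
Qed.

(** All points of the orbit lie in open tiles, so nearby points have the same itinerary. Along a
    segment this keeps the bound on the derivative fixed. *)
Lemma itinerary_bound_near k w : iter_defined F k w -> tiles F (iter k T w) ->
  \forall q \near w, bound k q = bound k w.
Proof.
elim: k => [|k IH].
  move=> _ _; apply: (@filterS _ (nbhs w) _ setT) filterT => q _.
  by rewrite /itinerary_bound !big_ord0.
move=> dk1 tk1; have [dk tk] := (iter_definedS F k w).1 dk1.
have h : \forall q \near w, index (iter k T q) = index (iter k T w) :=
  iter_continuous dk (tile_index_near tk).
have h' : \forall q \near w, index (iter k.+1 T q) = index (iter k.+1 T w) :=
  iter_continuous dk1 (tile_index_near tk1).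
apply: filterS3 (IH dk tk) h h' => q; rewrite !itinerary_boundS.
by move=> -> /= -> ->.
Qed.

Lemma base_coord_near k w (e : R) : disc_preimage k w -> 0 < e ->
  \forall q \near w, normc (base_coord k q - base_coord k w) < e.
Proof.
move=> [dk wk] e0; have [_ dom] := base_discP wk.
exact: (iter_continuous dk (chart_near dom e0)).
Qed.

Lemma disc_loop_lift k (g : R -> sphere R) : continuous g ->
  (forall t, disc_preimage k (g t)) ->
  base_coord k (g 0) = c -> base_coord k (g 1) = c -> g 0 = g 1.
Proof.
move=> cg gE; apply: (@loop_lift R _ (@sphere_dist R) (@sphere_dist_sym R)
  (@sphere_dist_triangle R) (@nbhs_sphere_dist R) (disc_preimage k)
  (base_coord k) c rho (@disc_preimage_compact k)) => //.
- by move=> e Ee r r0; exact: base_coord_near.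
- move=> e N Ee eN; have [dk wk] := Ee; have [nP _] := base_discP wk.
  have [_ /(_ _ (filterI eN (iter_defined_near dk)))] := iter_local_homeo dk nP.
  have [-> _] := base_coordP Ee; move=> /nbhs_some[r r0 Hr] _.
  exists r => // y yc yr; have [e' [Ne' de'] e'y] := Hr y yr.
  exists e'; split=> //; last by rewrite /base_coord e'y.
  by split=> //; rewrite e'y; exists y.
- move=> e Ee; have [dk wk] := Ee; have [nP _] := base_discP wk.
  have [_ _ [N eN NI]] := iter_local_homeo dk nP; exists N => //.
  move=> e' e'' Ee' Ee'' Ne' Ne'' E; apply: NI => //.
  by have [-> _] := base_coordP Ee'; have [-> _] := base_coordP Ee''; rewrite E.
- by move=> t; have [] := base_coordP (gE t).
Qed.

(** Bounds the conformal factor on the disc. At the source this factor is at least 1, so F^k read in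
    charts has derivative at most S(w) times [distortion]. *)
Definition distortion : R := 1 + (normc c + rho) ^+ 2.

Lemma distortion_gt0 : 0 < distortion.
Proof. by rewrite ltr_pwDl // sqr_ge0. Qed.

Lemma base_coord_conformal k w : disc_preimage k w ->
  conformal (base_coord k w) <= distortion.
Proof.
move=> /base_coordP[_ wc]; have cr0 : 0 <= normc c + rho.
  by apply: addr_ge0; [exact: normc_ge0|exact: ltW].
rewrite /conformal lerD2l ler_pXn2r ?nnegrE ?normc_ge0 //.
by apply: (le_trans (normc_le_distD _ c)); rewrite lerD2l.
Qed.

Section Segment.
Variables (k : nat) (b w : sphere R) (v : C).
Hypothesis dom_w : chart_dom b w.
Hypothesis dk : iter_defined F k w.
Hypothesis wc : iter k T w = Some c.
Hypothesis v_short : normc v * (bound k w * distortion) < rho.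

Let seg (t : R) : sphere R := chart_inv b (chart b w + t%:C%C * v).

Lemma segment_continuous : continuous seg.
Proof.
move=> t N; rewrite /seg => /(nbhs_chart _ (chart_inv_dom _ _))[r r0 Hr].
have v1 : 0 < normc v + 1 by rewrite ltr_wpDl ?normc_ge0.
apply/nbhs_ballP; exists (r / (normc v + 1)); first by rewrite /= divr_gt0.
move=> t'; rewrite /ball /= distrC => tt'; apply: Hr.
rewrite chart_invK opprD addrACA subrr add0r -mulrBl -rmorphB /= normcM normc_real.
apply: (@le_lt_trans _ _ (`|t' - t| * (normc v + 1))).
  by rewrite ler_wpM2l // lerDl.
by rewrite -ltr_pdivlMr.
Qed.

(** The invariant followed along the segment: the image moves away from c at speed at most rho, so
    it cannot leave the disc before time 1. *)
Let good t := [/\ disc_preimage k (seg t), bound k (seg t) = bound k w,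
  index (seg t) = index w & normc (base_coord k (seg t) - c) <= rho * t].

Lemma segment_lift t : 0 <= t <= 1 -> good t.
Proof.
have Ew : disc_preimage k w.
  by split=> //; rewrite wc; exists c => //; rewrite /cdisc /= subrr normc0 ltW.
apply: real_induction => [|{}t t01 [Et bt xt ct]|{}t t01 H].
- have -> : good 0 = [/\ disc_preimage k w, bound k w = bound k w,
    index w = index w & normc (base_coord k w - c) <= rho * 0].
    by rewrite /good /seg mul0r addr0 chartK.
  by split=> //; rewrite /base_coord wc /= subrr normc0 mulr0.
- set q := seg t in Et bt xt ct; set u := chart b w + t%:C%C * v.
  have dq : chart_dom b q by exact: chart_inv_dom.
  have [dkq fq] := Et; have [nPq domq] := base_discP fq.
  have tkq := base_disc_tiles fq.
  have sq := iter_sdiff dkq; have := iter_deriv_le Hsup i0 dkq tkq.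
  rewrite (sdiff_sderiv sq) bt => s_le.
  have [l dl lE] := sdiff_chart sq dq domq.
  have uq : chart b q = u by rewrite /q /seg chart_invK.
  rewrite uq in dl lE.
  have l_le : normc l <= bound k w * distortion.
    apply: (@le_trans _ _ (normc l * conformal u)).
      by rewrite ler_peMr ?normc_ge0 // lerDl sqr_ge0.
    rewrite lE; apply: ler_pM => //.
    - exact: sdiff_ge0 sq.
    - exact/ltW/conformal_gt0.
    - exact: (base_coord_conformal Et).
  have v1 : 0 < normc v + 1 by rewrite ltr_wpDl ?normc_ge0.
  (* The slack in [v_short], scaled so that the error of the linear approximation, at most e |v| per
     unit of time, fits into it. *)
  pose e := (rho - normc v * (bound k w * distortion)) / (normc v + 1).
  have e0 : 0 < e by rewrite divr_gt0 // subr_gt0.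
  have [d1 d10 Hd1] := dl e e0.
  have near_q : \forall q' \near q, [/\ iter_defined F k q', bound k q' = bound k w,
      index q' = index w & chart_dom (Some c : sphere R) (iter k T q')].
    have n1 := iter_defined_near dkq.
    have n2 := itinerary_bound_near dkq tkq.
    have n3 := tile_index_near (disc_preimage_tiles Et).
    have n4 : \forall q' \near q, chart_dom (Some c : sphere R) (iter k T q').
      apply: (iter_continuous dkq); apply: open_nbhs_nbhs; split=> //.
      exact: chart_dom_open.
    by apply: filterS2 (filterI n1 n2) (filterI n3 n4) => q' [? ->] [-> ?]; split.
  have [r r0 Hr] := (nbhs_chart _ dq).1 near_q.
  rewrite uq in Hr.
  pose d := Num.min (1 - t) (Num.min d1 r / (normc v + 1)).
  have d0 : 0 < d.
    rewrite lt_min subr_gt0 divr_gt0 // ?lt_min ?d10 // andbT.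
    by case/andP: t01.
  exists d => // t' /andP[tt' t'd].
  have {}t'd : t' - t < d by rewrite ltrBlDl.
  move: (t'd); rewrite lt_min ltrD2r ltr_pdivlMr // lt_min => /andP[t'1 /andP[h1 h2]].
  have t't : 0 < t' - t by rewrite subr_gt0.
  set u' := chart b w + t'%:C%C * v.
  have uu' : u' - u = (t' - t)%:C%C * v.
    by rewrite /u' /u opprD addrACA subrr add0r -mulrBl -rmorphB.
  have nuu' : normc (u' - u) = (t' - t) * normc v.
    by rewrite uu' normcM normc_real gtr0_norm.
  have nuu'1 : normc (u' - u) <= (t' - t) * (normc v + 1).
    by rewrite nuu' ler_wpM2l ?lerDl // ltW.
  have [dk' bk' ix' dom'] := Hr u' (le_lt_trans nuu'1 h2).
  have move_le : normc (base_coord k (seg t') - base_coord k q) <= rho * (t' - t).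
    have := Hd1 u' (le_lt_trans nuu'1 h1).
    rewrite /chart_map /= -/(seg t') -/(seg t) -/q => Hd.
    have := normc_le_distD (base_coord k (seg t') - base_coord k q) (l * (u' - u)).
    rewrite /base_coord normcM nuu' => h3; apply: (le_trans h3).
    apply: (@le_trans _ _ (normc l * ((t' - t) * normc v) + e * ((t' - t) * normc v))).
      by rewrite lerD2l -nuu'.
    rewrite -mulrDl mulrCA [leRHS]mulrC ler_wpM2l //; first exact: ltW.
    have ev : e * normc v <= rho - normc v * (bound k w * distortion).
      apply: (@le_trans _ _ (e * (normc v + 1))).
        by apply: ler_wpM2l; rewrite ?lerDl // ltW.
      by rewrite /e divfK // gt_eqF.
    have : normc l * normc v <= bound k w * distortion * normc v.
      by rewrite ler_wpM2r ?normc_ge0.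
    by rewrite mulrDl; lra.
  have c' : normc (base_coord k (seg t') - c) <= rho * t'.
    by have := normc_tri (base_coord k (seg t')) (base_coord k q) c; lra.
  have sE : iter k T (seg t') = Some (base_coord k (seg t')).
    by move: dom'; rewrite /base_coord -/(seg t'); case: (iter k T (seg t')).
  split=> //; split=> //; rewrite sE; exists (base_coord k (seg t')) => //.
  rewrite /cdisc /=; apply: (le_trans c').
  by rewrite ler_piMr // ltW.
- have nearby (N : set (sphere R)) : nbhs (seg t) N ->
      exists2 t', 0 <= t' < t & N (seg t').
    move=> /segment_continuous/nbhs_ballP[r /= r0 Hr].
    have t0 : 0 < t by case/andP: t01.
    have r20 : 0 < r / 2 by rewrite divr_gt0.
    exists (Num.max 0 (t - r / 2)).
      by rewrite le_max lexx /= gt_max t0 ltrBlDr ltrDl.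
    apply: Hr; rewrite /ball /=.
    have : t - r / 2 <= Num.max 0 (t - r / 2) by rewrite le_max lexx orbT.
    have : Num.max 0 (t - r / 2) < t by rewrite gt_max t0 ltrBlDr ltrDl.
    by move=> h1 h2; rewrite ltr_norml; apply/andP; split; lra.
  (* Compactness of the preimage of the disc keeps the limit point inside it, so the iterate is
     still defined there. *)
  have Et : disc_preimage k (seg t).
    have /(_ _) := compact_closed (@sphere_hausdorff R) (@disc_preimage_compact k).
    apply=> N /nearby[t' /H[Et' _ _ _] Nt']; by exists (seg t').
  have [dkt ft] := Et; have tkt := base_disc_tiles ft.
  have near1 : nbhs (seg t) ([set q | bound k q = bound k (seg t)] `&`
                             [set q | index q = index (seg t)]).
    apply: filterI; first exact: itinerary_bound_near.
    exact: (tile_index_near (disc_preimage_tiles Et)).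
  have [t' t't [b' x']] := nearby _ near1; have [_ b'' x'' _] := H t' t't.
  split=> //; first by rewrite -b'.
    by rewrite -x'.
  apply/ler_addgt0Pl => e e0.
  have [s st se] := nearby _ (base_coord_near Et e0); have [_ _ _ cs] := H s st.
  have := normc_tri (base_coord k (seg t)) (base_coord k (seg s)) c.
  rewrite (normc_distC (base_coord k (seg t)) (base_coord k (seg s))).
  have : rho * s <= rho * t by rewrite ler_wpM2l ?ltW //; case/andP: st.
  by rewrite /= in se; lra.
Qed.

End Segment.

Lemma preimage_separation k b w w' : chart_dom b w -> chart_dom b w' ->
  iter_defined F k w -> iter k T w = Some c -> iter k T w' = Some c -> w != w' ->
  rho / (bound k w * distortion) <= normc (chart b w - chart b w').
Proof.
move=> bw bw' dk wc w'c ww'; have tk : tiles F (iter k T w).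
  by rewrite wc; apply: base_disc_tiles; exists c => //; rewrite /cdisc /= subrr normc0 ltW.
have B0 : 0 < bound k w * distortion.
  by rewrite mulr_gt0 ?distortion_gt0 // itinerary_bound_gt0.
rewrite ler_pdivrMr // leNgt; apply/negP => short.
set v := chart b w' - chart b w; rewrite normc_distC -/v in short.
(* The segment is extended by constants to the whole line, where lifted paths are defined. *)
pose clamp (t : R) := Num.max 0 (Num.min t 1).
have clamp01 t : 0 <= clamp t <= 1.
  by rewrite /clamp le_max lexx /= ge_max ler01 ge_min lexx orbT.
pose g (t : R) : sphere R := chart_inv b (chart b w + (clamp t)%:C%C * v).
have cg : continuous g.
  move=> t; apply: (@continuous_comp _ _ _ clamp
    (fun t : R => chart_inv b (chart b w + t%:C%C * v))); last exact: segment_continuous.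
  have cmin : {for t, continuous ((id : R -> R^o) \min cst 1)}.
    by apply: continuous_min; [exact: cvg_id|exact: cvg_cst].
  by apply: (continuous_max (f := cst 0 : R -> R^o)) => //; exact: cvg_cst.
have gE t : disc_preimage k (g t).
  by have [] := segment_lift bw dk wc short (clamp01 t).
have g0 : g 0 = w.
  have c0 : clamp 0 = 0 by rewrite /clamp min_l // max_l.
  by rewrite /g c0 mul0r addr0 chartK.
have g1 : g 1 = w'.
  have c1 : clamp 1 = 1 by rewrite /clamp min_l // max_r.
  by rewrite /g c1 mul1r /v addrC subrK chartK.
have := disc_loop_lift cg gE; rewrite g0 g1 /base_coord wc w'c => /(_ erefl erefl).
by move/eqP; rewrite (negbTE ww').
Qed.

(** The same segments never change tile. This is the source of the upper bound on the radii in the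
    packing. *)
Lemma preimage_tile_radius k b w q : chart_dom b w -> chart_dom b q ->
  iter_defined F k w -> iter k T w = Some c -> ~ tile F (index w) q ->
  rho / (bound k w * distortion) <= normc (chart b w - chart b q).
Proof.
move=> bw bq dk wc nq; have tk : tiles F (iter k T w).
  by rewrite wc; apply: base_disc_tiles; exists c => //; rewrite /cdisc /= subrr normc0 ltW.
have B0 : 0 < bound k w * distortion.
  by rewrite mulr_gt0 ?distortion_gt0 // itinerary_bound_gt0.
rewrite ler_pdivrMr // leNgt; apply/negP => short; apply: nq.
set v := chart b q - chart b w; rewrite normc_distC -/v in short.
have [|E _ x _] := segment_lift (t := 1) bw dk wc short; first by rewrite ler01 lexx.
have qE : chart_inv b (chart b w + 1%:C%C * v) = q.
  by rewrite mul1r /v addrC subrK chartK.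
rewrite qE in E x; rewrite -x; have [i _ qi] := disc_preimage_tiles E.
by rewrite (tile_indexE _ qi).
Qed.

End Separation.

(** * Packing the preimages: bounded column sums at exponent 4 *)

Section Boundedness.
Variables (R : realType) (m : nat) (F : partitioned_system R m).
Local Notation C := (R[i]^o).
Local Notation T := (sysmap F).
Local Notation PC := (postcritical F).
Hypothesis Hne : image_tiles F `\` PC !=set0.
Hypothesis Hsup : forall i j : 'I_m, has_ubound (transition_derivs F i j).

(** A point other than 0 and infinity lies in the domain of both charts. *)
Lemma open_finite_point (V : set (sphere R)) : open V -> V !=set0 ->
  exists2 z : C, z != 0 & V (Some z).
Proof.
move=> oV [[a|] Va].
  have [a0|a0] := eqVneq a 0; last by exists a.
  have /nbhs_some[r r0 Hr] : nbhs (Some a : sphere R) V by apply: open_nbhs_nbhs.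
  have r2 : 0 < r / 2 by rewrite divr_gt0.
  exists (r / 2)%:C%C; first by rewrite -normc_gt0 normc_real gtr0_norm.
  apply: Hr; rewrite a0 subr0 normc_real gtr0_norm //.
  by rewrite ltr_pdivrMr // ltr_pMr // ltr1n.
have /nbhs_none[_ [M HM]] : nbhs (None : sphere R) V by apply: open_nbhs_nbhs.
have M1 : 0 < `|M| + 1 by rewrite ltr_wpDl.
exists (`|M| + 1)%:C%C; first by rewrite -normc_gt0 normc_real gtr0_norm.
by apply: HM; rewrite normc_real gtr0_norm // (le_lt_trans (ler_norm M)) // ltrDl.
Qed.

Section Zone.
Variables (i0 j0 : 'I_m) (c : C) (rho : R).
Hypothesis rho_gt0 : 0 < rho.
Hypothesis disc_tile : forall z, normc (z - c) <= rho ->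
  tile F j0 (Some z) /\ ~ PC (Some z).
Variables (ia ib : 'I_m) (za zb : C).
Hypothesis iab : ia != ib.
Hypothesis za_tile : tile F ia (Some za).
Hypothesis zb_tile : tile F ib (Some zb).
Hypothesis za_neq0 : za != 0.
Hypothesis zb_neq0 : zb != 0.

(** The sum |z| + 1/|z| bounds the modulus of z in either chart; the 1 accounts for the points that
    are packed. *)
Definition zone_radius : R :=
  1 + (normc za + (normc za)^-1) + (normc zb + (normc zb)^-1).

Lemma zone_sum k (b : sphere R) (s : seq (sphere R)) : uniq s ->
  (forall w, w \in s -> [/\ chart_dom b w, normc (chart b w) <= 1,
     iter_defined F k w & iter k T w = Some c]) ->
  \sum_(w <- s) itinerary_bound F i0 k w `^ (- 4%:R) <=
  (distortion c rho / rho) ^+ 4 * (2 * (36 * zone_radius ^+ 2) ^+ 2).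
Proof.
move=> us sP; pose D := distortion c rho.
have D0 : 0 < D by exact: distortion_gt0.
have na : 0 < normc za by rewrite normc_gt0.
have nb : 0 < normc zb by rewrite normc_gt0.
have nai : 0 < (normc za)^-1 by rewrite invr_gt0.
have nbi : 0 < (normc zb)^-1 by rewrite invr_gt0.
have B0 : 0 < zone_radius by rewrite /zone_radius; lra.
have c_tile : tiles F (Some c).
  by exists j0 => //; apply: (disc_tile _).1; rewrite subrr normc0 ltW.
have bound0 w : w \in s -> 0 < itinerary_bound F i0 k w.
  by move=> /sP[_ _ dk wc]; apply: itinerary_bound_gt0 => //; rewrite wc.
pose r w := rho / (itinerary_bound F i0 k w * D).
rewrite (_ : \sum_(w <- s) _ = (D / rho) ^+ 4 * \sum_(w <- s) r w ^+ 4); last first.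
  rewrite mulr_sumr big_seq [RHS]big_seq; apply: eq_bigr => w /bound0 w0.
  rewrite powRN powR_mulrn ?ltW // /r; field.
  by rewrite !gt_eqF.
apply: ler_wpM2l; first by apply: exprn_ge0; apply: divr_ge0; exact: ltW.
have chart_le z : z != 0 -> normc (chart b (Some z : sphere R)) <= normc z + (normc z)^-1.
  move=> z0; have nz : 0 < normc z by rewrite normc_gt0.
  case: (b) => [?|] /=; first by rewrite lerDl invr_ge0 ltW.
  by rewrite normcV lerDr ltW.
have dom z : z != 0 -> chart_dom b (Some z : sphere R).
  by move=> z0; case: (b) => [?|] //= [] E; rewrite E eqxx in z0.
apply: (packing_sum (a := chart b)) => //.
- by move=> w /sP[_ h _ _]; apply: (le_trans h); rewrite /zone_radius; lra.
- move=> w ws; have [bw w1 dk wc] := sP w ws.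
  rewrite divr_gt0 ?mulr_gt0 ?bound0 //=.
  have far z : z != 0 -> ~ tile F (tile_index F i0 w) (Some z) ->
      r w <= normc (chart b w) + normc (chart b (Some z : sphere R)).
    move=> z0 nz; apply: (le_trans (preimage_tile_radius Hne Hsup rho_gt0 disc_tile
      bw (dom z z0) dk wc nz)).
    by apply: (le_trans (le_normcD _ _)); rewrite normcN.
  (* The points [za] and [zb] lie in different tiles, so at least one of them is outside the tile of
     w and limits the radius at w. *)
  have [E|ne] := eqVneq (tile_index F i0 w) ia.
    have := far zb zb_neq0; have := chart_le zb zb_neq0; rewrite /zone_radius.
    move=> h1 h2; have {}h2 : r w <= normc (chart b w) + normc (chart b (Some zb : sphere R)).
      by apply: h2; rewrite E => h; move: iab; rewrite (tile_inj h zb_tile) eqxx.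
    by rewrite /r in h2 *; lra.
  have := far za za_neq0; have := chart_le za za_neq0; rewrite /zone_radius.
  move=> h1 h2; have {}h2 : r w <= normc (chart b w) + normc (chart b (Some za : sphere R)).
    by apply: h2 => h; move: ne; rewrite (tile_inj h za_tile) eqxx.
  by rewrite /r in h2 *; lra.
- move=> w w' ws w's ww'; have [bw _ dk wc] := sP w ws; have [bw' _ _ w'c] := sP w' w's.
  have := preimage_separation Hne Hsup i0 rho_gt0 disc_tile bw bw' dk wc w'c ww'.
  by rewrite /r /D.
Qed.

End Zone.

Lemma col_sums_bounded : (2 <= m)%N ->
  exists j0, exists K : R, forall k, col_sums F 4%:R k 0 j0 <= K.
Proof.
move=> m2; have [j0 [p [pj0 npc]]] := noncritical_tile Hne.
have [c _ [cj0 cPC]] : exists2 c : C, c != 0 & (tile F j0 `&` ~` PC) (Some c).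
  apply: open_finite_point; last by exists p.
  apply: openI; first exact: tile_open.
  by apply: closed_openC; exact: closed_closure.
have /nbhs_some[r r0 Hr] : nbhs (Some c : sphere R) (tile F j0 `&` [set z | ~ PC z]).
  by apply: filterI; [exact: (tile_near cj0)|exact: (postcritical_near cPC)].
pose rho := r / 2; have rho0 : 0 < rho by rewrite divr_gt0.
have disc_tile z : normc (z - c) <= rho -> tile F j0 (Some z) /\ ~ PC (Some z).
  move=> zr; apply: Hr; apply: (le_lt_trans zr).
  by rewrite ltr_pdivrMr // ltr_pMr // ltr1n.
have point i : exists2 z : C, z != 0 & tile F i (Some z).
  apply: open_finite_point; first exact: tile_open.
  by have [z zi _] := noncritical_point Hne i; exists z.
pose ia := Ordinal (ltnW m2); pose ib := Ordinal m2.
have [za za0 zat] := point ia; have [zb zb0 zbt] := point ib.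
set K := (distortion c rho / rho) ^+ 4 * (2 * (36 * zone_radius za zb ^+ 2) ^+ 2).
exists j0, (K + K) => k.
have [s [us sP <-]] := iter_preimages Hne Hsup j0 k cj0 cPC.
(* Infinity goes with the second zone, where the chart 1/z has modulus at most 1. *)
pose zone (w : sphere R) := if w is Some z then normc z <= 1 else false.
have zsum b (P : pred (sphere R)) :
    (forall w, P w -> chart_dom b w /\ normc (chart b w) <= 1) ->
    \sum_(w <- s | P w) itinerary_bound F j0 k w `^ (- 4%:R) <= K.
  move=> HP; rewrite -big_filter.
  apply: (@zone_sum j0 j0 c rho rho0 disc_tile ia ib za zb _ zat zbt za0 zb0 k b) => //.
    by rewrite filter_uniq.
  by move=> w; rewrite mem_filter => /andP[/HP[? ?] /sP[? ?]].
rewrite (bigID zone) /=; apply: lerD.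
  by apply: (zsum (Some c)) => -[z|].
have n01 : normc (0 : C) <= 1 by rewrite normc0 ler01.
apply: (zsum None) => -[z|] //=.
rewrite -ltNge => z1; rewrite normcV; split.
  by move=> [z0]; move: z1; rewrite z0 normc0 ltNge ler01.
by rewrite invf_le1 ?(ltW z1) // (lt_trans _ z1).
Qed.

End Boundedness.

(** * The spectral radius and the pressure *)

Lemma log_lipschitz_IVT (R : realType) (r : R -> R) (L t : R) : 0 <= L ->
  (forall s, 0 < r s) -> (forall s s', r s' <= expR (`|s - s'| * L) * r s) ->
  0 <= t -> 1 <= r 0 -> r t <= 1 -> exists2 s, 0 <= s <= t & r s = 1.
Proof.
move=> L0 r_gt0 lip t0 r0 rt.
have ln_lip s s' : ln (r s') <= ln (r s) + `|s - s'| * L.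
  rewrite -ler_expR expRD (lnK _) ?posrE // (lnK _) ?posrE // mulrC.
  exact: lip.
have cont : {within `[0, t], continuous (fun s => ln (r s))}.
  apply: continuous_subspaceT => s N /nbhs_ballP[e /= e0 He].
  have L1 : 0 < L + 1 by rewrite ltr_wpDl.
  apply/nbhs_ballP; exists (e / (L + 1)); first by rewrite /= divr_gt0.
  move=> s' ss'; apply: He; rewrite /ball /= in ss' *.
  rewrite ltr_pdivlMr // in ss'.
  have h : `|s - s'| * L <= `|s - s'| * (L + 1) by rewrite ler_wpM2l // lerDl.
  have := ln_lip s s'; have := ln_lip s' s; rewrite (distrC s' s) => h1 h2.
  by rewrite ltr_norml; apply/andP; split; lra.
have [|s st s1] := @IVT R (fun s => ln (r s)) 0 t 0 t0 cont.
  rewrite ge_min le_max; apply/andP; split; apply/orP.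
    by right; exact: ln_le0.
  by left; exact: ln_ge0.
exists s; first by move: st; rewrite in_itv.
by apply/eqP; rewrite -ln_eq0 // s1.
Qed.

Section Conclusion.
Variables (R : realType) (m : nat) (F : partitioned_system R m).
Local Notation T := (sysmap F).
Local Notation PC := (postcritical F).
Local Notation M t := (mcmullen_matrix F t).
Local Notation rad t := (spectral_radius (mcmullen_matrix F t)).
Hypothesis m2 : (2 <= m)%N.
Hypothesis Hne : image_tiles F `\` PC !=set0.
Hypothesis Hsup : forall i j : 'I_m, has_ubound (transition_derivs F i j).

Let m0 : (0 < m)%N := ltnW m2.

(** The row of ones dominates x / X, for x the left Perron vector and X the sum of its coordinates,
    and the nonnegative matrix preserves this. *)
Lemma col_sums_growth t j : exists2 a : R, 0 < a &
  forall k, a * rad t ^+ k <= col_sums F t k 0 j.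
Proof.
have [M0 _] := mcmullen_irreducible Hne Hsup t.
have [x [_ [r0 [x0 _] xM _]]] := perron_spectral_radius m0 (mcmullen_irreducible Hne Hsup t).
pose X := \sum_i x 0 i.
have xX i : x 0 i <= X.
  by rewrite /X (bigD1 i) //= lerDl sumr_ge0 // => k _; exact: ltW.
have X0 : 0 < X by exact: lt_le_trans (x0 j) (xX j).
exists (x 0 j / X); first by rewrite divr_gt0.
move=> k; rewrite mulrAC ler_pdivrMr //.
elim: k j => [|k IH] j; first by rewrite expr0 mulr1 mxE mul1r.
have -> : x 0 j * rad t ^+ k.+1 = rad t ^+ k * (rad t *: x) 0 j.
  by rewrite exprSr mxE; ring.
rewrite -xM /= [(x *m _) 0 j]mxE mxE mulr_sumr mulr_suml; apply: ler_sum => i _.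
rewrite mulrA [leRHS]mulrAC; apply: ler_wpM2r => //.
by rewrite mulrC.
Qed.

Lemma pow_unbounded (r a K : R) : 0 < a -> (forall k, a * r ^+ k <= K) -> r <= 1.
Proof.
move=> a0 H; rewrite leNgt; apply/negP => r1.
have bern k : 1 + k%:R * (r - 1) <= r ^+ k.
  elim: k => [|k IH]; first by rewrite mul0r addr0.
  have r0 : 0 <= r by rewrite ltW // (lt_trans _ r1).
  have k0 : 0 <= k%:R :> R by [].
  rewrite exprS; apply: (@le_trans _ _ (r * (1 + k%:R * (r - 1)))).
    by rewrite -natr1; have := mulr_ge0 k0 (sqr_ge0 (r - 1)); lra.
  by rewrite ler_wpM2l.
pose k := (Num.truncn (`|K| / (a * (r - 1)))).+1.
have ar : 0 < a * (r - 1) by rewrite mulr_gt0 // subr_gt0.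
have : `|K| < k%:R * (a * (r - 1)) by rewrite -ltr_pdivrMr // truncnS_gt.
have := H k; have := bern k; have := ler_norm K.
move=> h1 h2 h3 h4; have : a * (1 + k%:R * (r - 1)) <= a * r ^+ k by rewrite ler_wpM2l // ltW.
by rewrite mulrDr mulrCA; lra.
Qed.

Lemma spectral_radius4_le1 : rad 4%:R <= 1.
Proof.
have [j [K HK]] := col_sums_bounded Hne Hsup m2.
have [a a0 Ha] := col_sums_growth 4%:R j.
by apply: (pow_unbounded (K := K) a0) => k; exact: le_trans (Ha k) (HK k).
Qed.

(** Connectedness to a second tile provides a nonempty path from i. *)
Lemma transition_out (i : 'I_m) : exists j, transition F i j.
Proof.
have [i' ii'] : exists i' : 'I_m, i' != i.
  have [E|] := eqVneq (Ordinal m0) i; last by exists (Ordinal m0).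
  by exists (Ordinal m2); rewrite -E.
have /connectP[[|j p] /=] := transition_connect Hne i i'.
  by move=> _ E; rewrite E eqxx in ii'.
by move=> /andP[ij _] _; exists j.
Qed.

(** At t = 0 the nonzero entries are degrees and every row has one, so the row sums are at least 1
    and multiplication by the matrix does not decrease the total mass of x. *)
Lemma spectral_radius0_ge1 : 1 <= rad 0.
Proof.
have irr := mcmullen_irreducible Hne Hsup 0.
have [x [_ [_ [x0 _] xM _]]] := perron_spectral_radius m0 irr.
have X0 : 0 < \sum_i x 0 i.
  by rewrite (bigD1 (Ordinal m0)) //= ltr_pwDl // sumr_ge0 // => i _; exact: ltW.
rewrite -(ler_pM2r X0) mul1r mulr_sumr.
have -> : \sum_i rad 0 * x 0 i = \sum_j (x *m M 0) 0 j.
  by apply: eq_bigr => j _; rewrite xM mxE.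
under [leRHS]eq_bigr do rewrite mxE.
rewrite exchange_big /=; apply: ler_sum => i _; rewrite -mulr_sumr.
have [j ij] := transition_out i; apply: ler_peMr; first exact: ltW.
rewrite (bigD1 j) //=; apply: ler_wpDr.
  by apply: sumr_ge0 => k _; case: irr.
rewrite mcmullenE ij oppr0 powRr0 mulr1 ler1n; exact: (degree_gt0 Hne ij).
Qed.

Definition log_range : R := \sum_i \sum_j `|ln (sup_deriv F i j)|.

Lemma log_range_ge i j : `|ln (sup_deriv F i j)| <= log_range.
Proof.
rewrite /log_range (bigD1 i) //= (bigD1 j) //= -addrA lerDl addr_ge0 //.
  by apply: sumr_ge0.
by apply: sumr_ge0 => k _; apply: sumr_ge0.
Qed.

Lemma log_range_ge0 : 0 <= log_range.
Proof. by apply: sumr_ge0 => i _; apply: sumr_ge0. Qed.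

(** From t to t' an entry is multiplied by a power of exponent t - t' of its supremum, and
    [log_range] controls the logarithms of all the suprema. *)
Lemma spectral_radius_lipschitz t t' :
  rad t' <= expR (`|t - t'| * log_range) * rad t.
Proof.
apply: spectral_radius_le => //; [exact: mcmullen_irreducible|exact: mcmullen_irreducible|].
move=> i j; rewrite !mcmullenE; case: ifPn => [ij|_]; last by rewrite mulr0.
have s0 := sup_deriv_gt0 Hne Hsup ij.
rewrite mulrCA ler_wpM2l // /powR gt_eqF // -expRD ler_expR.
have : (t - t') * ln (sup_deriv F i j) <= `|t - t'| * log_range.
  apply: (le_trans (ler_norm _)); rewrite normrM ler_wpM2l //; exact: log_range_ge.
by lra.
Qed.

Lemma spectral_radius_gt0 t : 0 < rad t.
Proof.
have := spectral_radius_lipschitz t 0; have := spectral_radius0_ge1 => h1 h2.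
have := lt_le_trans ltr01 (le_trans h1 h2).
by rewrite pmulr_rgt0 // expR_gt0.
Qed.

Lemma delta_set_below t : 0 <= t -> rad t <= 1 ->
  exists2 s, 0 <= s <= t & delta_set F s.
Proof.
move=> t0 rt; have [s st rs] := log_lipschitz_IVT log_range_ge0
  spectral_radius_gt0 spectral_radius_lipschitz t0 spectral_radius0_ge1 rt.
by exists s => //; split=> //; case/andP: st.
Qed.

Lemma pressure_at_ge t z : 0 <= t -> tiles F z -> ~ PC z ->
  ((ln (rad t))%:E <= pressure_at F z t)%E.
Proof.
move=> t0 [j _ zj] nP; have [a a0 Ha] := col_sums_growth t j.
apply: le_ereal_inf_tmp => _ [V [N _ NV] <-].
apply/lee_addgt0Pr => e e0.
(* V contains all indices from N on; k is one of them, positive, and so large that |ln a| / k <=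
   e. *)
pose k := maxn N.+1 (Num.truncn (`|ln a| / e)).+1.
have Vk : V k by apply: NV => /=; rewrite leq_max leqnSn.
have k0 : 0 < k%:R :> R by rewrite ltr0n leq_max.
move: (rad t) (spectral_radius_gt0 t) Ha => r r0 Ha.
have ark : 0 < a * r ^+ k by rewrite mulr_gt0 // exprn_gt0.
have Th : ((a * r ^+ k)%:E <= Theta F k z t)%E.
  apply: le_trans (Theta_ge Hne Hsup j k t0 zj nP).
  by rewrite lee_fin; exact: Ha.
have lnTh : ((ln a + k%:R * ln r)%:E <= lne (Theta F k z t))%E.
  have -> : (ln a + k%:R * ln r)%:E = lne (a * r ^+ k)%:E.
    by rewrite lne_EFin // lnM ?posrE ?exprn_gt0 // lnXn // mulr_natl.
  have h1 : (a * r ^+ k)%:E \in `[0%E, +oo%E] by rewrite in_itv /= leey andbT lee_fin ltW.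
  rewrite lee_lne //; rewrite in_itv /= leey andbT; apply: le_trans Th.
  by rewrite lee_fin ltW.
have main : ((ln r - e)%:E <= (k%:R^-1)%:E * lne (Theta F k z t))%E.
  apply: (@le_trans _ _ ((k%:R^-1)%:E * (ln a + k%:R * ln r)%:E)%E).
    rewrite -EFinM lee_fin mulrDr mulKf ?gt_eqF // addrC lerD2r.
    rewrite lerNl -mulrN mulrC ler_pdivrMr //.
    apply: (@le_trans _ _ `|ln a|); first by rewrite -normrN ler_norm.
    rewrite mulrC -ler_pdivrMr // ltW // (lt_le_trans (truncnS_gt _)) //.
    by rewrite ler_nat leq_maxr.
  by apply: lee_wpmul2l => //; rewrite lee_fin invr_ge0 ltW.
apply: (@le_trans _ _ ((ln r - e)%:E + e%:E)%E).
  by rewrite -EFinD subrK.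
rewrite leeD2r // (le_trans main) //.
by apply: ereal_sup_ubound; exists k.
Qed.

Lemma pressure_le0_spectral_radius t : 0 <= t -> (pressure F t <= 0)%E ->
  rad t <= 1.
Proof.
move=> t0 Pt; rewrite leNgt; apply/negP => r1.
have : ((ln (rad t))%:E <= pressure F t)%E.
  by apply: le_ereal_inf_tmp => _ [z [tz nP] <-]; exact: pressure_at_ge.
by move=> /le_trans/(_ Pt); rewrite lee_fin leNgt ln_gt0.
Qed.

End Conclusion.

(* Hsup: the suprema in McMullen's matrix are finite, i.e. its entries are real
   numbers for every t >= 0. If a supremum is infinite, then reading its power
   of exponent -t as 0 for t > 0 can make the set defining delta empty. *)
Theorem theorem2p6 (R : realType) (m : nat) (Hm : (2 <= m)%N)
    (F : partitioned_system R m)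
    (Hopen : open (image_tiles F `\` postcritical F))
    (Hne : image_tiles F `\` postcritical F !=set0)
    (Hsup : forall i j : 'I_m, has_ubound (transition_derivs F i j)) :
  delta_set F !=set0 /\ ((delta F)%:E <= poincare_exponent F)%E.
Proof.
split.
  have [s _ ds] := delta_set_below Hm Hne Hsup (ler0n R 4) (spectral_radius4_le1 Hm Hne Hsup).
  by exists s.
apply: le_ereal_inf_tmp => _ [t [t0 Pt] <-]; rewrite lee_fin.
have rt := pressure_le0_spectral_radius Hm Hne Hsup (ltW t0) Pt.
have [s /andP[_ st] ds] := delta_set_below Hm Hne Hsup (ltW t0) rt.
(* The set is bounded below by 0, so [inf] is a genuine infimum. *)
apply: le_trans st; apply: ge_inf => //.
by exists 0 => u [].
Qed.
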